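(* Let $a,b\in\operatorname{Alg}\mathcal{N}$. The multiplication operator $M_{a,b}:\operatorname{Alg}\mathcal{N}\to\operatorname{Alg}\mathcal{N}$, $x\mapsto axb$, is weakly compact if and only if one of the following conditions is satisfied: 1. $U_a>L_b$. 2. $U_a=L_b=S$ and the operators $SaS$ and $S^{\perp}bS^{\perp}$ are both compact. 3. $U_a=L_b=S$, the operator $SaS$ is compact, the operator $S^{\perp}bS^{\perp}$ is non-compact, and for any $\varepsilon>0$ there exists a projection $P\in\mathcal{N}$, $P>S$, such that $\|a(P-S)\|<\varepsilon$. 4. $U_a=L_b=S$, the operator $S^{\perp}bS^{\perp}$ is compact, the operator $SaS$ is non-compact, and for any $\varepsilon>0$ there exists a projection $P\in\mathcal{N}$, $P<S$, such that $\|(S-P)b\|<\varepsilon$.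
   Context: $\mathcal{N}$ is a nest on a Hilbert space $H$: a totally ordered family of closed subspaces of $H$ containing $\{0\}$ and $H$ and closed under intersections and closed linear spans of arbitrary subfamilies. Subspaces in $\mathcal{N}$ are identified with their orthogonal projections; $P^{\perp}=I-P$. $\operatorname{Alg}\mathcal{N}$ is the algebra of all bounded operators $T$ on $H$ with $T(N)\subseteq N$ for all $N\in\mathcal{N}$. $\vee$ denotes closed linear span and $\wedge$ intersection of families of subspaces. For $a,b\in\operatorname{Alg}\mathcal{N}$, $$U_a=\vee\{P\in\mathcal{N}:PaP\text{ is a compact operator}\},\qquad L_b=\wedge\{P\in\mathcal{N}:P^{\perp}bP^{\perp}\text{ is a compact operator}\}.$$ *)

(* Defs.v *)
From HB Require Import structures.
From mathcomp Require Import all_boot all_order all_algebra.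
From mathcomp Require Import sesquilinear complex ring lra.
From mathcomp Require Import all_classical all_reals.
From mathcomp Require Import topology normedtype.

Set Implicit Arguments.
Unset Strict Implicit.
Unset Printing Implicit Defensive.

Import Order.TTheory GRing.Theory Num.Theory.
Import numFieldNormedType.Exports.

Local Open Scope classical_set_scope.
Local Open Scope ring_scope.

Section NormedModules.
Context {K : numFieldType}.

Definition closed_unit_ball (V : normedModType K) : set V :=
  [set x | `|x| <= 1].

Arguments closed_unit_ball V _ : clear implicits.

Definition cdual (V : normedModType K) : Type :=
  {phi : {scalar V} | continuous (phi : V -> K^o)}.

Definition cdual_eval (V : normedModType K) (x : V) : {ptws cdual V -> K^o} :=
  fun phi => sval phi x.

(* V with its weak topology: the coarsest one for which every element of the
   dual of V is continuous *)
Definition weak (V : normedModType K) : Type :=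
  initial_topology (@cdual_eval V).
HB.instance Definition _ (V : normedModType K) :=
  Topological.copy (weak V) (initial_topology (@cdual_eval V)).

(* [precompact] means that the closure is compact *)
Definition compact_op (V W : normedModType K) (f : V -> W) : Prop :=
  precompact (f @` closed_unit_ball V).

Definition weakly_compact_op (V W : normedModType K) (f : V -> W) : Prop :=
  precompact ((f : V -> weak W) @` closed_unit_ball V).

Definition subspace_set (V : lmodType K) (M : set V) : Prop :=
  M 0 /\ forall (c : K) (u v : V), M u -> M v -> M (c *: u + v).

Definition closed_subspace (V : normedModType K) (M : set V) : Prop :=
  closed M /\ subspace_set M.

Definition closed_span (V : normedModType K) (A : set V) : set V :=
  closure (smallest (@subspace_set V) A).

(* In the last two fields, an empty subfamily gives the whole space and the
   zero subspace respectively *)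
Record nest (V : normedModType K) : Type := Nest {
  nest_sets :> set V -> Prop ;
  nest_subspace : forall P, nest_sets P -> closed_subspace P ;
  nest_total : forall P Q, nest_sets P -> nest_sets Q -> P `<=` Q \/ Q `<=` P ;
  nest_zero : nest_sets [set 0] ;
  nest_full : nest_sets setT ;
  nest_bigcap : forall F, F `<=` nest_sets -> nest_sets (\bigcap_(P in F) P) ;
  nest_span : forall F, F `<=` nest_sets ->
    nest_sets (closed_span (\bigcup_(P in F) P))
}.

End NormedModules.

Arguments closed_unit_ball {K} V _.

Section OperatorNorm.
Context {R : realType}.
Local Notation C := R[i].

(* Norms over C are valued in C, whence the [Re] *)
Definition bounded_op (V W : normedModType C) (f : V -> W) : Prop :=
  exists M : R, forall x, complex.Re `|f x| <= M * complex.Re `|x|.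

Definition opnorm (V W : normedModType C) (f : V -> W) : R :=
  sup [set complex.Re `|f x| | x in closed_unit_ball V].

End OperatorNorm.

Section OperatorNormTheory.
Context {R : realType} {V W : normedModType R[i]}.
Implicit Types f g : V -> W.

Lemma Re_norm_ge0 (U : normedModType R[i]) (x : U) : 0 <= complex.Re `|x|.
Proof. by have := normr_ge0 x; rewrite lecE => /andP[]. Qed.

Lemma Re_normK (U : normedModType R[i]) (x : U) :
  (complex.Re `|x|)%:C%C = `|x|.
Proof.
have := normr_ge0 x; rewrite lecE => /andP[/eqP] /=.
by case: (`|x|) => a b /= -> _.
Qed.

Lemma Re_normD (U : normedModType R[i]) (x y : U) :
  complex.Re `|x + y| <= complex.Re `|x| + complex.Re `|y|.
Proof.
by rewrite -lecR rmorphD /= !Re_normK ler_normD.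
Qed.

Lemma Re_normZ (U : normedModType R[i]) (c : R[i]) (x : U) :
  complex.Re `|c *: x| = complex.Re `|c| * complex.Re `|x|.
Proof.
apply: (@complexI R); rewrite rmorphM /= !Re_normK normrZ.
by congr (_ * _); case: c => a b.
Qed.

Lemma opnorm_has_sup f : bounded_op f ->
  has_sup [set complex.Re `|f x| | x in closed_unit_ball V].
Proof.
move=> [M fM]; split.
  by exists (complex.Re `|f 0|), 0 => //; rewrite /closed_unit_ball /= normr0.
exists `|M| => _ [x x1 <-]; apply: (le_trans (fM x)).
apply: (@le_trans _ _ (`|M| * complex.Re `|x|)).
  by rewrite ler_wpM2r ?Re_norm_ge0 ?ler_norm.
rewrite -[leRHS]mulr1 ler_wpM2l ?normr_ge0 //.
by rewrite -lecR Re_normK.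
Qed.

Lemma opnorm_ub f x : bounded_op f -> `|x| <= 1 ->
  complex.Re `|f x| <= opnorm f.
Proof.
by move=> /opnorm_has_sup bf x1; apply: sup_upper_bound => //; exists x.
Qed.

Lemma opnorm_le f (M : R) :
  (forall x, `|x| <= 1 -> complex.Re `|f x| <= M) -> opnorm f <= M.
Proof.
move=> fM; apply: ge_sup.
  by exists (complex.Re `|f 0|), 0 => //; rewrite /closed_unit_ball /= normr0.
by move=> _ [x x1 <-]; exact: fM.
Qed.

Lemma opnormD f g : bounded_op f -> bounded_op g ->
  opnorm (fun x => f x + g x) <= opnorm f + opnorm g.
Proof.
move=> bf bg; apply: opnorm_le => x x1.
by rewrite (le_trans (Re_normD _ _)) // lerD // opnorm_ub.
Qed.

Lemma opnorm_ge0 f : bounded_op f -> 0 <= opnorm f.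
Proof.
move=> bf; apply: (le_trans (Re_norm_ge0 (f 0))).
by rewrite opnorm_ub // normr0.
Qed.

Lemma bounded_opZ (c : R[i]) f : bounded_op f -> bounded_op (fun x => c *: f x).
Proof.
move=> [M fM]; exists (complex.Re `|c| * M) => x.
by rewrite Re_normZ -mulrA ler_wpM2l // (Re_norm_ge0 (c : R[i]^o)).
Qed.

Lemma opnormZ (c : R[i]) f : bounded_op f ->
  opnorm (fun x => c *: f x) = complex.Re `|c| * opnorm f.
Proof.
move=> bf; have c0 : 0 <= complex.Re `|c| := Re_norm_ge0 (c : R[i]^o).
apply/eqP; rewrite eq_le; apply/andP; split.
  by apply: opnorm_le => x x1; rewrite Re_normZ ler_wpM2l // opnorm_ub.
have [->|cn0] := eqVneq (complex.Re `|c|) 0.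
  by rewrite mul0r opnorm_ge0 //; exact: bounded_opZ.
have cp : 0 < complex.Re `|c| by rewrite lt_def cn0 c0.
rewrite mulrC -ler_pdivlMr //; apply: opnorm_le => x x1.
rewrite ler_pdivlMr // mulrC -Re_normZ.
by apply: (@opnorm_ub (fun x => c *: f x)) => //; exact: bounded_opZ.
Qed.

End OperatorNormTheory.

Section NestAlgebra.
Context {R : realType} {H : normedModType R[i]}.
Implicit Type N : nest H.

Definition nest_alg_set N : set (H -> H) :=
  [set T | [/\ linear T, bounded_op T & forall P, N P -> T @` P `<=` P]].

Definition nest_alg_pred N : {pred H -> H} := mem (nest_alg_set N).

Record nest_alg N : Type := NestAlg {
  nest_alg_fun :> H -> H ;
  nest_alg_funP : nest_alg_fun \in nest_alg_pred N
}.

HB.instance Definition _ N := [isSub for @nest_alg_fun N].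
HB.instance Definition _ N := [Choice of nest_alg N by <:].

Lemma nest_algP N (T : nest_alg N) : nest_alg_set N T.
Proof. exact/set_mem/nest_alg_funP. Qed.

Lemma nest_alg_submod_closed N : submod_closed (nest_alg_pred N).
Proof.
split=> [|c f g].
  apply/mem_set; split.
  - by move=> c x y; rewrite /= scaler0 addr0.
  - by exists 0 => x; rewrite /= normr0 mul0r.
  - by move=> P /nest_subspace[_ [P0 _]] _ [x _ <-].
move=> /set_mem[lf bf Nf] /set_mem[lg bg Ng]; apply/mem_set; split.
- move=> k x y; rewrite /= !fctE lf lg !scalerDr !scalerA (mulrC c).
  by rewrite addrACA.
- have [M cfM] := bounded_opZ c bf; have [M' gM'] := bg.
  exists (M + M') => x; rewrite mulrDl (le_trans (Re_normD _ _)) // lerD //.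
  exact: cfM.
- move=> P NP _ [x Px <-].
  by apply: (nest_subspace NP).2.2; [apply: (Nf P NP)|apply: (Ng P NP)]; exists x.
Qed.

HB.instance Definition _ N :=
  GRing.isSubmodClosed.Build _ _ (nest_alg_pred N) (nest_alg_submod_closed N).
HB.instance Definition _ N := [SubChoice_isSubLmodule of nest_alg N by <:].

Definition nest_alg_norm N (T : nest_alg N) : R[i] := (opnorm T)%:C%C.

Lemma nest_alg_ler_normD N (S T : nest_alg N) :
  nest_alg_norm (S + T) <= nest_alg_norm S + nest_alg_norm T.
Proof.
have [_ bS _] := nest_algP S; have [_ bT _] := nest_algP T.
by rewrite /nest_alg_norm -rmorphD lecR; exact: opnormD.
Qed.

Lemma nest_alg_normrZ N (c : R[i]) (T : nest_alg N) :
  nest_alg_norm (c *: T) = `|c| * nest_alg_norm T.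
Proof.
have [_ bT _] := nest_algP T.
rewrite -[in RHS](@Re_normK _ (R[i]^o) c) /nest_alg_norm -rmorphM /=.
by congr (_%:C)%C; exact: opnormZ.
Qed.

Lemma nest_alg_normr0_eq0 N (T : nest_alg N) : nest_alg_norm T = 0 -> T = 0.
Proof.
have [lT bT _] := nest_algP T.
move=> /(@complexI R) T0; apply/val_inj/funext => x /=.
have small (y : H) : `|y| <= 1 -> T y = 0.
  move=> y1; apply/eqP; rewrite -normr_eq0 -Re_normK; apply/eqP.
  congr (_%:C)%C; apply/eqP; rewrite eq_le Re_norm_ge0 andbT -T0.
  exact: opnorm_ub.
have [->|x0] := eqVneq x 0; first by apply: small; rewrite normr0 ler01.
have nx0 : `|x| != 0 by rewrite normr_eq0.
have TZ k y : T (k *: y) = k *: T y.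
  by have := lT k y 0; rewrite addr0 (small 0) ?normr0 ?ler01 // addr0.
rewrite -[x](scale1r) -(divff nx0) -scalerA TZ small ?scaler0 //.
by rewrite normrZ normfV normr_id mulVf.
Qed.

HB.instance Definition _ N := Lmodule_isNormed.Build R[i] (nest_alg N)
  (@nest_alg_ler_normD N) (@nest_alg_normrZ N) (@nest_alg_normr0_eq0 N).

Lemma nest_alg_comp_subproof N (S T : nest_alg N) :
  S \o T \in nest_alg_pred N.
Proof.
have [lS [M SM] NS] := nest_algP S; have [lT [M' TM'] NT] := nest_algP T.
apply/mem_set; split.
- by move=> k x y; rewrite /= lT lS.
- exists (`|M| * M') => x; rewrite /= (le_trans (SM _)) //.
  apply: (@le_trans _ _ (`|M| * complex.Re `|T x|)).
    by rewrite ler_wpM2r ?Re_norm_ge0 ?ler_norm.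
  by rewrite -mulrA ler_wpM2l.
- by move=> P NP _ [x Px <-]; apply: (NS P NP); exists (T x) => //; apply: NT NP _ _; exists x.
Qed.

Definition nest_alg_comp N (S T : nest_alg N) : nest_alg N :=
  NestAlg (nest_alg_comp_subproof S T).

Definition mul_op N (a b : nest_alg N) : nest_alg N -> nest_alg N :=
  fun x => nest_alg_comp a (nest_alg_comp x b).

End NestAlgebra.

Section Projections.
Context {R : realType} {H : completeNormedModType R[i]}.

(* A Hilbert space is a complete normed space whose norm comes from an inner
   product; [{dot H for Num.conj}] is linear in its first argument *)
Definition inner_product_norm (ip : {dot H for Num.conj}) : Prop :=
  forall x, `|x| ^+ 2 = ip x x.

Variable ip : {dot H for Num.conj}.

Definition is_orth_proj (M : set H) (x y : H) : Prop :=
  M y /\ forall z, M z -> ip (x - y) z = 0.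

(* By [orth_projP] and [is_orth_proj_uniq], the default value 0 is never used
   when M is a closed subspace *)
Definition orth_proj (M : set H) : H -> H := fun x => xget 0 (is_orth_proj M x).

Definition orth_projC (M : set H) : H -> H := fun x => x - orth_proj M x.

Lemma is_orth_proj_uniq (M : set H) x y y' : subspace_set M ->
  is_orth_proj M x y -> is_orth_proj M x y' -> y = y'.
Proof.
move=> [M0 MZ] [My oy] [My' oy'].
have Myy' : M (y - y') by rewrite addrC -scaleN1r; exact: MZ.
apply/eqP; rewrite -subr_eq0 -(dnorm_eq0 ip).
rewrite {1}(_ : y - y' = (x - y') - (x - y)).
  by rewrite linearBl /= oy // oy' // subr0.
by rewrite opprB [RHS]addrC addrA subrK.
Qed.

Lemma is_orth_proj_exists (M : set H) x : inner_product_norm ip ->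
  closed_subspace M -> exists y, is_orth_proj M x y.
Proof.
move=> hip [cM [M0 MZ]].
have [Q [Qdef QE]] : exists Q : H -> R,
    (forall u, Q u = complex.Re `|u| ^+ 2) /\ forall u, (Q u)%:C%C = ip u u.
  exists (fun u => complex.Re `|u| ^+ 2); split=> // u.
  by rewrite rmorphXn /= Re_normK hip.
have Q0 u : 0 <= Q u by rewrite Qdef exprn_ge0 // Re_norm_ge0.
pose D := inf [set Q (x - m) | m in M].
have infD : has_inf [set Q (x - m) | m in M].
  split; first by exists (Q (x - 0)), 0.
  by exists 0 => _ [m _ <-].
have DQ m : M m -> D <= Q (x - m).
  by move=> Mm; apply: ge_inf; [exact: infD.2|exists m].
pose A (e : R) := [set m | M m /\ Q (x - m) < D + e].
have A0 e : 0 < e -> A e !=set0.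
  by move=> e0; have [_ [m Mm <-] Qm] := inf_adherent e0 infD; exists m.
have para u v : Q (u - v) = 2 * Q u + 2 * Q v - Q (u + v).
  apply: (@complexI R); rewrite rmorphB rmorphD !rmorphM /= !rmorph_nat !QE.
  rewrite dnormB dnormD; ring.
have Q4 u : Q (2 *: u) = 4 * Q u.
  apply: (@complexI R); rewrite rmorphM /= rmorph_nat !QE dnormZ normr_nat.
  by rewrite -natrX.
have Mhalf m m' : M m -> M m' -> M (2^-1 *: (m + m')).
  move=> Mm Mm'; rewrite -[_ *: _]addr0; apply: (MZ) => //.
  by rewrite -[m]scale1r; exact: MZ.
have AQ d m m' : A d m -> A d m' -> Q (m - m') < 4 * d.
  move=> [Mm Qm] [Mm' Qm'].
  have -> : m - m' = (x - m') - (x - m) by rewrite opprB [RHS]addrC addrA subrK.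
  rewrite para; have := DQ _ (Mhalf _ _ Mm' Mm).
  have -> : (x - m') + (x - m) = 2 *: (x - 2^-1 *: (m' + m)).
    rewrite scalerBr scalerA divff ?pnatr_eq0 // scale1r scaler_nat mulr2n.
    by rewrite opprD addrACA.
  by rewrite Q4; lra.
have Qlt u (r : R) : 0 < r -> Q u < r ^+ 2 -> `|u| < r%:C%C.
  move=> r0; rewrite Qdef ltr_pXn2r // ?nnegrE ?Re_norm_ge0 ?(ltW r0) //.
  by rewrite -ltcR Re_normK.
pose F := filter_from [set e : R | 0 < e] A.
have FF : ProperFilter F.
  apply: filter_from_proper => //; apply: filter_from_filter.
    by exists 1 => /=.
  move=> e f /= e0 f0; exists (Num.min e f); first by rewrite /= lt_min e0.
  by move=> m [Mm Qm]; split; split=> //; apply: (lt_le_trans Qm);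
    rewrite lerD2l ge_min lexx ?orbT.
have Fc : F --> lim F.
  apply: cauchy_cvg; apply: cauchy_exP => e e0.
  have [er r0] : e = (complex.Re e)%:C%C /\ 0 < complex.Re e.
    by move: e0; case: e => a b; rewrite ltcE /= => /andP[/eqP-> ->].
  move: er r0; set r := complex.Re e => -> r0.
  have d0 : 0 < r ^+ 2 / 8 by rewrite divr_gt0 // exprn_gt0.
  have [m Am] := A0 _ d0; exists m; exists (r ^+ 2 / 8) => // m' Am'.
  rewrite -ball_normE /=; apply: Qlt => //; apply: (lt_le_trans (AQ _ _ _ Am Am')).
  by have := sqr_ge0 r; lra.
set y := lim F in Fc.
have My : M y.
  by apply: (@closed_cvg _ _ F _ id M cM _ y Fc); exists 1 => //= m [].
have Qy : Q (x - y) <= D.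
  rewrite leNgt; apply/negP => Dlt.
  pose p := complex.Re `|x - y|; pose t := Num.sqrt ((D + Q (x - y)) / 2).
  have D0 : 0 <= D by apply: lb_le_inf => [|_ [m _ <-] //]; exact: infD.1.
  have t2 : t ^+ 2 = (D + Q (x - y)) / 2.
    by rewrite sqr_sqrtr // divr_ge0 // addr_ge0 // (le_trans D0 (ltW Dlt)).
  have tp : t < p.
    rewrite -(@ltr_pXn2r _ 2) // ?nnegrE ?sqrtr_ge0 ?Re_norm_ge0 // t2 -Qdef.
    by lra.
  have e0 : 0 < (p - t)%:C%C by rewrite ltcR subr_gt0.
  have [d /= d0 Ad] := Fc _ (nbhsx_ballx y _ e0).
  pose d' := Num.min d ((Q (x - y) - D) / 2).
  have d'0 : 0 < d' by rewrite lt_min d0 /= divr_gt0 // subr_gt0.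
  have [m [Mm Qm]] := A0 _ d'0.
  have : ball y (p - t)%:C%C m.
    by apply: Ad; split=> //; apply: (lt_le_trans Qm); rewrite lerD2l ge_min lexx.
  rewrite -ball_normE /= -Re_normK ltcR distrC => ym.
  have xm : complex.Re `|x - m| < t.
    rewrite -(@ltr_pXn2r _ 2) // ?nnegrE ?sqrtr_ge0 ?Re_norm_ge0 // t2 -Qdef.
    apply: (lt_le_trans Qm).
    apply: (@le_trans _ _ (D + (Q (x - y) - D) / 2)); last by lra.
    by rewrite lerD2l ge_min lexx orbT.
  have := Re_normD (x - m) (m - y); rewrite addrA subrK -/p.
  by lra.
have Qw m : M m -> Q (x - y) <= Q (x - y - m).
  move=> Mm; apply: (le_trans Qy); rewrite -addrA -opprD; apply: DQ.
  by rewrite addrC -[m]scale1r; exact: MZ.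
exists y; split=> // z Mz; move: (x - y) Qw => w Qw.
have [->|z0] := eqVneq z 0; first by rewrite linear0r.
have n0 : 0 < ip z z by rewrite dnorm_gt0.
pose d := `|ip w z| ^+ 2 / ip z z.
have d0 : 0 <= d by rewrite divr_ge0 ?exprn_ge0 // ltW.
have : Q w <= Q (w - (ip w z / ip z z) *: z).
  by apply: Qw; rewrite -[_ *: _]addr0; apply: (MZ).
rewrite -lecR !QE dnormB dnormZ.
have -> : ip w ((ip w z / ip z z) *: z) = d.
  rewrite linearZr_LR /= rmorphM /= fmorphV /= /d normCK.
  by rewrite (conj_Creal (gtr0_real n0)) mulrAC [_^* * _]mulrC.
rewrite (conj_Creal (ger0_real d0)) normrM exprMn normfV (gtr0_norm n0).
have -> : `|ip w z| ^+ 2 * (ip z z)^-1 ^+ 2 * ip z z = d.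
  by rewrite /d expr2 !mulrA mulfVK // gt_eqF.
rewrite opprD addrA addrK lerBrDr gerDl => dle.
have : d == 0 by rewrite eq_le dle d0.
rewrite mulf_eq0 expf_eq0 normr_eq0 invr_eq0 (gt_eqF n0) orbF.
by move/eqP.
Qed.

Lemma orth_projP (M : set H) x : inner_product_norm ip ->
  closed_subspace M -> is_orth_proj M x (orth_proj M x).
Proof.
move=> hip /(is_orth_proj_exists x hip)[y Py].
exact: (@xgetI _ 0 (is_orth_proj M x) y).
Qed.

Variable N : nest H.

(* The subspace U_a *)
Definition upper_space (a : nest_alg N) : set H :=
  closed_span (\bigcup_(P in [set P | N P /\
    compact_op (orth_proj P \o a \o orth_proj P)]) P).

(* The subspace L_b *)
Definition lower_space (b : nest_alg N) : set H :=
  \bigcap_(P in [set P | N P /\ compact_op (orth_projC P \o b \o orth_projC P)]) P.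

End Projections.

(* Main.v *)
Require Import Defs.
From HB Require Import structures.
From mathcomp Require Import all_boot all_order all_algebra.
From mathcomp Require Import sesquilinear complex ring lra.
From mathcomp Require Import all_classical all_reals.
From mathcomp Require Import topology normedtype.

(** Write ~ for the orthocomplement.  If P is in the nest then x P = P x P and
    P~ x = P~ x P~, so that a x b = (a P) x b + (a P~) x (P~ b).

    Sufficiency.  Each of the four conditions provides, for every d > 0, some P
    in the nest such that a P and P~ b are within d of finite rank operators.
    On the unit ball of the nest algebra, which is compact for the weak
    operator topology, ||a x b|| is then bounded, up to a multiple of d, by
    finitely many norms ||rho_i x|| with rho_i continuous from the weak
    operator topology to the weak topology of H.  A Mazur type argument, which
    replaces extending functionals from the nest algebra to all bounded
    operators, shows that x |-> phi (a x b) is continuous on that ball for every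
    functional phi, so the image of the ball is weakly compact.

    Necessity.  If all conditions fail, there are d > 0 and orthonormal
    sequences f_n, g_n such that x_n = <., g_n> f_n is in the nest algebra, the
    vectors a f_n are pairwise orthogonal, ||a f_n|| >= d and ||b* g_n|| >= d.
    The partial sums y_n of the series of the a x_k b form a bounded sequence.
    With c_k(y) = <y b* g_k, a f_k> we have c_k(y_n) = 0 for k > n, whereas
    c_k(y_n) = ||b* g_k||^2 ||a f_k||^2 >= d^4 for k <= n.  A weak cluster point
    Y of the y_n satisfies c_k(Y) >= d^4 for all k, but the limit of the c_k
    along a free ultrafilter is a bounded functional vanishing on every y_n.

    The f_n and g_n are produced from non-compactness: if T is not compact on a
    closed subspace which is the closure of the union of a chain of subspaces,
    then, uniformly over finite sets s, some member of the chain contains a unit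
    vector orthogonal to s on which T is bounded below. *)

Set Implicit Arguments.
Unset Strict Implicit.
Unset Printing Implicit Defensive.

Import Order.TTheory GRing.Theory Num.Theory.
Import numFieldNormedType.Exports.

Local Open Scope classical_set_scope.
Local Open Scope ring_scope.

Local Notation rn x := (complex.Re `|x|).

(** * Real-valued norms and moduli over the complex field *)

Section RealNorm.
Context {R : realType} {V : normedModType R[i]}.
Implicit Types (x y : V) (r : R).

Lemma Re_norm_le x r : (`|x| <= r%:C%C) = (rn x <= r).
Proof. by rewrite -lecR Re_normK. Qed.

Lemma Re_norm_lt x r : (`|x| < r%:C%C) = (rn x < r).
Proof. by rewrite -ltcR Re_normK. Qed.

Lemma Re_norm_le1 x : (`|x| <= 1) = (rn x <= 1).
Proof. exact: Re_norm_le. Qed.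

Lemma Re_norm0 : rn (0 : V) = 0.
Proof. by rewrite normr0. Qed.

Lemma Re_norm_eq0 x : (rn x == 0) = (x == 0).
Proof.
rewrite -[x == 0]normr_eq0 -[X in _ = (X == 0)]Re_normK.
by apply/eqP/eqP => [-> //|/(@complexI R)].
Qed.

Lemma Re_normB x y : rn (x - y) <= rn x + rn y.
Proof. by rewrite -[rn y](_ : rn (- y) = _) ?Re_normD // normrN. Qed.

Lemma Re_normZr r x : 0 <= r -> rn (r%:C%C *: x) = r * rn x.
Proof. by move=> r0; rewrite Re_normZ ger0_norm ?ler0c. Qed.

Lemma Re_norm_sum (I : Type) (s : seq I) (F : I -> V) :
  rn (\sum_(i <- s) F i) <= \sum_(i <- s) rn (F i).
Proof.
elim: s => [|i s IH]; first by rewrite !big_nil Re_norm0.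
by rewrite !big_cons (le_trans (Re_normD _ _)) // lerD2l.
Qed.

(** Radii of balls are complex numbers here, but a positive complex number is real, so real radii
    suffice. *)
Lemma Re_norm_cvg (T : Type) (F : set_system T) (f : T -> V) x :
  Filter F ->
  (f @ F --> x <-> forall e : R, 0 < e -> F [set t | rn (x - f t) < e]).
Proof.
move=> FF; split=> [/cvgrPdist_lt fx e e0|fx].
  have {}e0 : 0 < e%:C%C by rewrite ltcR.
  apply: filterS (fx _ e0) => t /=.
  by rewrite Re_norm_lt.
apply/cvgrPdist_lt => e e0.
have [er r0] : e = (complex.Re e)%:C%C /\ 0 < complex.Re e.
  by move: e0; case: e => a b; rewrite ltcE /= => /andP[/eqP-> ->].
by rewrite er; apply: filterS (fx _ r0) => t /=; rewrite Re_norm_lt.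
Qed.

End RealNorm.

Lemma Re_norm_lipschitz_continuous {R : realType} (V W : normedModType R[i])
    (f : V -> W) (M : R) :
  (forall x y, rn (f x - f y) <= M * rn (x - y)) -> continuous f.
Proof.
move=> fM x; apply/Re_norm_cvg => e e0.
(* The sign of [M] is unknown, so [e] is divided by a positive majorant of [M]. *)
have M1 : 0 < `|M| + 1 by rewrite ltr_wpDl.
have /Re_norm_cvg : id @ nbhs x --> x by exact: cvg_id.
move=> /(_ _ (divr_gt0 e0 M1)); apply: filterS => t /=.
rewrite ltr_pdivlMr //; apply: le_lt_trans; apply: le_trans (fM _ _) _.
rewrite mulrC ler_wpM2l ?Re_norm_ge0 // (le_trans (ler_norm _)) //.
by rewrite lerDl.
Qed.

Section Modulus.
Context {R : realType}.
Implicit Types c d : R[i].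

Lemma Re_normc_ge0 c : 0 <= rn c.
Proof. exact: (@Re_norm_ge0 _ (R[i]^o)). Qed.

Lemma Re_normcD c d : rn (c + d) <= rn c + rn d.
Proof. exact: (@Re_normD _ (R[i]^o)). Qed.

Lemma Re_normcB c d : rn (c - d) <= rn c + rn d.
Proof. exact: (@Re_normB _ (R[i]^o)). Qed.

Lemma Re_normcK c : (rn c)%:C%C = `|c|.
Proof. exact: (@Re_normK _ (R[i]^o)). Qed.

Lemma Re_normcM c d : rn (c * d) = rn c * rn d.
Proof. exact: (@Re_normZ _ (R[i]^o)). Qed.

Lemma Re_normc_real (r : R) : 0 <= r -> rn r%:C%C = r.
Proof. by move=> r0; rewrite ger0_norm ?ler0c. Qed.

Lemma Re_norm_conj c : rn c^*%C = rn c.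
Proof. by case: c => a b /=; rewrite sqrrN. Qed.

Lemma ReD c d : complex.Re (c + d) = complex.Re c + complex.Re d.
Proof. by case: c d => a b []. Qed.

Lemma ReZ (r : R) c : complex.Re (r%:C%C * c) = r * complex.Re c.
Proof. by case: c => a b /=; rewrite mul0r subr0. Qed.

Lemma ler_Re c : `|complex.Re c| <= rn c.
Proof. by rewrite -lecR Re_normcK; exact: normc_ge_Re. Qed.

Lemma Re_norm_le_ReIm c : rn c <= `|complex.Re c| + `|complex.Im c|.
Proof.
case: c => a b /=; rewrite -[leRHS]ger0_norm ?addr_ge0 // -sqrtr_sqr.
rewrite ler_wsqrtr // -(real_normK (num_real a)) -(real_normK (num_real b)).
by rewrite sqrrD addrAC lerDl mulrn_wge0 // mulr_ge0.
Qed.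

Lemma ler_Im c : `|complex.Im c| <= rn c.
Proof. by case: c => a b /=; rewrite -sqrtr_sqr ler_wsqrtr // lerDr sqr_ge0. Qed.

End Modulus.

(** * Hilbert space geometry *)

Section InnerProduct.
Context {R : realType} {H : completeNormedModType R[i]}.
Variables (ip : {dot H for Num.conj}) (hip : inner_product_norm ip).
Implicit Types (x y z : H) (M : set H) (T : H -> H).

Lemma ipE x : ip x x = (rn x ^+ 2)%:C%C.
Proof. by rewrite -hip -[in LHS]Re_normK rmorphXn. Qed.

Lemma ip_conj x y : ip x y = (ip y x)^*.
Proof. by rewrite hermC expr0 mul1r. Qed.

Lemma ipZl (c : R[i]) x y : ip (c *: x) y = c * ip x y.
Proof. exact: linearZl_LR. Qed.

Lemma ipZr (c : R[i]) x y : ip x (c *: y) = c^* * ip x y.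
Proof. exact: linearZr_LR. Qed.

Lemma ip_eq0C x y : ip x y = 0 -> ip y x = 0.
Proof. by move=> xy; rewrite ip_conj xy rmorph0. Qed.

Lemma Re_ipC x y : complex.Re (ip x y) = complex.Re (ip y x).
Proof. by rewrite ip_conj; case: (ip y x). Qed.

Lemma Re_norm_ipC x y : rn (ip x y) = rn (ip y x).
Proof. by rewrite ip_conj; exact: Re_norm_conj. Qed.

Lemma sqr_normD x y :
  rn (x + y) ^+ 2 = rn x ^+ 2 + rn y ^+ 2 + 2 * complex.Re (ip x y).
Proof.
apply: (@complexI R); rewrite -ipE dnormD !ipE !rmorphD /=.
by rewrite (addcJ (ip x y)) [(2 * _)%:C%C]rmorphM /= rmorph_nat.
Qed.

Lemma pythagoras x y : ip x y = 0 -> rn (x + y) ^+ 2 = rn x ^+ 2 + rn y ^+ 2.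
Proof. by move=> xy; rewrite sqr_normD xy mulr0 addr0. Qed.

Lemma pythagoras_le x y : ip x y = 0 -> rn x <= rn (x + y).
Proof.
move=> /pythagoras xy.
rewrite -(@ler_pXn2r _ 2) ?nnegrE ?Re_norm_ge0 // xy.
by rewrite lerDl exprn_ge0 ?Re_norm_ge0.
Qed.

Lemma ip_inj x y : (forall z, ip x z = ip y z) -> x = y.
Proof.
move=> xy; apply/eqP; rewrite -subr_eq0 -(dnorm_eq0 ip).
by rewrite linearBl /= xy subrr.
Qed.

Lemma ip1_norm x : ip x x = 1 -> rn x = 1.
Proof.
rewrite ipE => /(@complexI R)/eqP; rewrite sqrf_eq1 => /orP[/eqP//|/eqP x1].
by have := Re_norm_ge0 x; rewrite x1 oppr_ge0 ler10.
Qed.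

(** With [c = ip x y / ip y y], the vector [x - c *: y] is orthogonal to [c *: y], so Pythagoras
    bounds the norm of [c *: y] by that of [x]. *)
Lemma ip_CauchySchwarz x y : rn (ip x y) <= rn x * rn y.
Proof.
have [->|y0] := eqVneq y 0; first by rewrite linear0r normr0 Re_norm0 mulr0.
have y1 : 0 < rn y by rewrite lt_def Re_norm_eq0 y0 Re_norm_ge0.
pose c := ip x y / ip y y.
have o : ip (x - c *: y) (c *: y) = 0.
  rewrite ipZr linearBl /= ipZl /c divfK ?dnorm_eq0 //.
  by rewrite subrr mulr0.
have := pythagoras_le (ip_eq0C o); rewrite addrC subrK Re_normZ.
rewrite /c ipE -fmorphV Re_normcM Re_normc_real ?invr_ge0 ?sqr_ge0 //.
by rewrite expr2 invfM mulrA divfK ?gt_eqF // ler_pdivrMr.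
Qed.

(** Testing with [y = x / |x|] suffices. Norm bounds for adjoints and for weakly defined operators
    are obtained this way. *)
Lemma rn_le_ip x (r : R) : 0 <= r ->
  (forall y, rn y <= 1 -> rn (ip x y) <= r) -> rn x <= r.
Proof.
move=> r0 xr; have [->|x0] := eqVneq x 0; first by rewrite Re_norm0.
have x1 : 0 < rn x by rewrite lt_def Re_norm_eq0 x0 Re_norm_ge0.
have := xr ((rn x)^-1%:C%C *: x).
rewrite Re_normZr ?invr_ge0 ?Re_norm_ge0 // mulVf ?gt_eqF // lexx => /(_ isT).
rewrite ipZr Re_normcM ipE Re_norm_conj.
rewrite !Re_normc_real ?invr_ge0 ?sqr_ge0 ?Re_norm_ge0 //.
by rewrite expr2 mulrA mulVf ?gt_eqF // mul1r.
Qed.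

End InnerProduct.

Section LinearMaps.
Context {R : realType} {U V : lmodType R[i]} (T : U -> V).
Hypothesis lT : linear T.

Lemma linear_D x y : T (x + y) = T x + T y.
Proof. by have := lT 1 x y; rewrite !scale1r. Qed.

Lemma linear_0 : T 0 = 0.
Proof. by apply: (addIr (T 0)); rewrite add0r -linear_D addr0. Qed.

Lemma linear_Z c x : T (c *: x) = c *: T x.
Proof. by have := lT c x 0; rewrite linear_0 !addr0. Qed.

Lemma linear_N x : T (- x) = - T x.
Proof. by rewrite -scaleN1r linear_Z scaleN1r. Qed.

Lemma linear_B x y : T (x - y) = T x - T y.
Proof. by rewrite linear_D linear_N. Qed.

Lemma linear_sum_seq (I : Type) (s : seq I) (F : I -> U) :
  T (\sum_(i <- s) F i) = \sum_(i <- s) T (F i).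
Proof. by apply: big_morph; [exact: linear_D|exact: linear_0]. Qed.

End LinearMaps.

Section Subspaces.
Context {R : realType} {V : lmodType R[i]} (M : set V).
Hypothesis sM : subspace_set M.

Lemma subspaceZ c x : M x -> M (c *: x).
Proof. by move=> Mx; rewrite -[_ *: _]addr0; apply: sM.2 => //; exact: sM.1. Qed.

Lemma subspaceD x y : M x -> M y -> M (x + y).
Proof. by move=> Mx My; rewrite -[x]scale1r; exact: sM.2. Qed.

Lemma subspaceB x y : M x -> M y -> M (x - y).
Proof. by move=> Mx My; rewrite -scaleN1r addrC; exact: sM.2. Qed.

Lemma subspace_sum (I : eqType) (s : seq I) (F : I -> V) :
  (forall i, i \in s -> M (F i)) -> M (\sum_(i <- s) F i).
Proof.
move=> MF; rewrite big_seq; elim/big_ind: _ => //; first exact: sM.1.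
by move=> x y; exact: subspaceD.
Qed.

End Subspaces.

Section Projection.
Context {R : realType} {H : completeNormedModType R[i]}.
Variables (ip : {dot H for Num.conj}) (hip : inner_product_norm ip).
Variable M : set H.
Hypothesis cM : closed_subspace M.
Implicit Types x y z : H.

Local Notation P := (orth_proj ip M).
Local Notation PC := (orth_projC ip M).

Lemma orth_proj_in x : M (P x).
Proof. by have [] := orth_projP x hip cM. Qed.

Lemma orth_projC_ip x z : M z -> ip (PC x) z = 0.
Proof. by have [_] := orth_projP x hip cM; apply. Qed.

Lemma orth_proj_uniq x y : M y -> (forall z, M z -> ip (x - y) z = 0) -> P x = y.
Proof.
move=> My xy; apply: (is_orth_proj_uniq cM.2 (orth_projP x hip cM)).
by split.
Qed.

Lemma orth_proj_id x : M x -> P x = x.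
Proof. by move=> Mx; apply: orth_proj_uniq => // z _; rewrite subrr linear0l. Qed.

Lemma orth_proj_perp x : (forall z, M z -> ip x z = 0) -> P x = 0.
Proof.
by move=> xM; apply: orth_proj_uniq => [|z]; [exact: cM.2.1|rewrite subr0; exact: xM].
Qed.

Lemma orth_projD x : P x + PC x = x.
Proof. by rewrite addrC subrK. Qed.

Lemma orth_proj_linear : linear P.
Proof.
move=> c x y; apply: orth_proj_uniq => [|z Mz].
  by apply: cM.2.2; exact: orth_proj_in.
rewrite opprD addrACA -scalerBr linearDl /= ipZl.
by rewrite ![ip (_ - _) _](orth_projC_ip _ Mz) mulr0 addr0.
Qed.

Lemma orth_projC_linear : linear PC.
Proof.
by move=> c x y; rewrite /orth_projC orth_proj_linear opprD addrACA scalerBr.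
Qed.

Lemma orth_projC_id x : M x -> PC x = 0.
Proof. by move=> /orth_proj_id; rewrite /orth_projC => ->; rewrite subrr. Qed.

Lemma orth_proj_le x : rn (P x) <= rn x.
Proof.
rewrite -{2}[x]orth_projD; apply: (pythagoras_le hip).
by apply: ip_eq0C; exact: (orth_projC_ip x (orth_proj_in x)).
Qed.

Lemma orth_projC_le x : rn (PC x) <= rn x.
Proof.
rewrite -{2}[x]orth_projD addrC; apply: (pythagoras_le hip).
exact: (orth_projC_ip x (orth_proj_in x)).
Qed.

Lemma orth_proj_ipl x z : M z -> ip (P x) z = ip x z.
Proof.
by move=> Mz; rewrite -{2}[x]orth_projD linearDl /= (orth_projC_ip _ Mz) addr0.
Qed.

Lemma orth_proj_adj x y : ip (P x) y = ip x (P y).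
Proof.
rewrite -(orth_proj_ipl _ (orth_proj_in y)).
rewrite [RHS]ip_conj [LHS]ip_conj; congr (_^*).
by rewrite orth_proj_ipl //; exact: orth_proj_in.
Qed.

Lemma orth_projC_adj x y : ip (PC x) y = ip x (PC y).
Proof. by rewrite linearBl linearBr /= orth_proj_adj. Qed.

End Projection.

(** * Riesz representation and adjoints *)

Section Riesz.
Context {R : realType} {H : completeNormedModType R[i]}.
Variables (ip : {dot H for Num.conj}) (hip : inner_product_norm ip).

(** Let [w] be the component orthogonal to the kernel of a vector outside it. Then
    [x - (phi x / phi w) *: w] lies in the kernel, hence is orthogonal to [w], which determines
    [phi x] from [ip x w]. *)
Lemma Riesz_representation (phi : H -> R[i]^o) (M : R) :
  linear phi -> (forall x, rn (phi x) <= M * rn x) ->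
  exists h, forall x, phi x = ip x h.
Proof.
move=> lphi bphi.
have cphi : continuous phi.
  apply: (@Re_norm_lipschitz_continuous _ _ _ _ M) => x y.
  by rewrite -linear_B.
pose K := [set x | phi x = 0].
have cK : closed_subspace K.
  split; last first.
    split=> [|c u v]; rewrite /K /= ?linear_0 // lphi => -> ->.
    by rewrite scaler0 addr0.
  apply: ((continuous_closedP phi).1 cphi [set 0]).
  by apply: accessible_closed_set1; apply: hausdorff_accessible; exact: norm_hausdorff.
have [K1|] := pselect (forall x, phi x = 0).
  by exists 0 => x; rewrite linear0r K1.
move=> /existsNP[x0 /eqP px0].
pose w := orth_projC ip K x0.
have pw : phi w = phi x0.
  by rewrite linear_B // (orth_proj_in hip cK x0 : phi _ = 0) subr0.
have w0 : ip w w != 0.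
  rewrite dnorm_eq0; apply: contra_neq px0 => w0.
  by rewrite -pw w0 linear_0.
exists ((phi w / ip w w)^* *: w) => x.
have : ip (x - (phi x / phi w) *: w) w = 0.
  apply: ip_eq0C; apply: (orth_projC_ip hip cK).
  by rewrite /K /= linear_B // linear_Z // [_ *: _](@divfK R[i]) ?pw // subrr.
rewrite linearBl /= ipZl => /eqP; rewrite subr_eq0 => /eqP xw.
rewrite ipZr xw conjCK mulrACA mulVf // mulr1.
by rewrite [RHS]mulrC [RHS]divfK // pw.
Qed.

(** The default value 0 does not occur for linear bounded [T], by [adjointE]. *)
Definition adjoint (T : H -> H) (y : H) : H :=
  xget 0 [set h | forall x, ip (T x) y = ip x h].

Variable T : H -> H.
Hypotheses (lT : linear T) (bT : bounded_op T).

Lemma adjointE x y : ip (T x) y = ip x (adjoint T y).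
Proof.
have [M TM] := bT.
have lphi : linear (fun x => ip (T x) y : R[i]^o).
  by move=> c u v; rewrite lT linearDl /= ipZl.
have [u|h hP] := Riesz_representation (M := M * rn y) lphi.
  apply: (le_trans (ip_CauchySchwarz hip _ _)).
  by rewrite mulrAC ler_wpM2r ?Re_norm_ge0.
exact: (@xgetI _ 0 [set h | forall x, ip (T x) y = ip x h] h).
Qed.

Lemma adjoint_uniq y h : (forall x, ip (T x) y = ip x h) -> adjoint T y = h.
Proof.
move=> Th; apply: (@ip_inj _ _ ip) => z.
by rewrite ip_conj -adjointE Th -ip_conj.
Qed.

Lemma adjoint_linear : linear (adjoint T).
Proof.
move=> c x y; apply: adjoint_uniq => z.
by rewrite !linearDr /= !ipZr !adjointE.
Qed.

Lemma adjoint_le (M : R) : 0 <= M -> (forall x, rn (T x) <= M * rn x) ->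
  forall x, rn (adjoint T x) <= M * rn x.
Proof.
move=> M0 TM x; apply: (rn_le_ip hip); first by rewrite mulr_ge0 ?Re_norm_ge0.
move=> y y1; rewrite Re_norm_ipC -adjointE.
apply: (le_trans (ip_CauchySchwarz hip _ _)); rewrite ler_wpM2r ?Re_norm_ge0 //.
by rewrite (le_trans (TM _)) // -[leRHS]mulr1 ler_wpM2l.
Qed.

Lemma bounded_op_pos : exists2 M : R, 0 < M & forall x, rn (T x) <= M * rn x.
Proof.
have [M TM] := bT; exists (`|M| + 1) => [|x]; first by rewrite ltr_wpDl.
by rewrite (le_trans (TM x)) // ler_wpM2r ?Re_norm_ge0 //
  (le_trans (ler_norm _)) // lerDl.
Qed.

Lemma adjoint_bounded : bounded_op (adjoint T).
Proof.
by have [M M0 TM] := bounded_op_pos; exists M; apply: adjoint_le; rewrite ?ltW.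
Qed.

End Riesz.

(** * Projections onto finite-dimensional spans *)

Section FiniteProjection.
Context {R : realType} {H : completeNormedModType R[i]}.
Variables (ip : {dot H for Num.conj}) (hip : inner_product_norm ip).
Implicit Types (x y z : H) (s : seq H) (M : set H).

(** For orthonormal [s] this is the orthogonal projection onto the span of [s]; then [fproj s y = y]
    expresses that [y] lies in that span. *)
Definition fproj s x : H := \sum_(e <- s) ip x e *: e.

Lemma fproj_linear s : linear (fproj s).
Proof.
move=> c x y; rewrite /fproj scaler_sumr -big_split; apply: eq_bigr => e _ /=.
by rewrite linearDl /= ipZl scalerDl scalerA.
Qed.

Lemma fproj_in M s x : subspace_set M -> (forall e, e \in s -> M e) ->
  M (fproj s x).
Proof.
by move=> sM Ms; apply: subspace_sum => // e es; apply: subspaceZ => //; exact: Ms.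
Qed.

Lemma fproj_perp s y x : (forall e, e \in s -> ip e y = 0) -> ip (fproj s x) y = 0.
Proof.
move=> sy; rewrite /fproj linear_sumlz big_seq big1 // => e es /=.
by rewrite ipZl sy // mulr0.
Qed.

Lemma orthonormal_norm s e : orthonormal ip s -> e \in s -> rn e = 1.
Proof.
by move=> /orthonormalP[_ os] es; apply: (ip1_norm hip); rewrite os // eqxx.
Qed.

Lemma fproj_norm_le s x : orthonormal ip s ->
  rn (fproj s x) <= \sum_(e <- s) rn (ip x e).
Proof.
move=> os; apply: (le_trans (Re_norm_sum _ _)).
rewrite !big_seq; apply: ler_sum => e es.
by rewrite Re_normZ (orthonormal_norm os es) mulr1.
Qed.

Section Orthonormal.
Variable s : seq H.
Hypothesis os : orthonormal ip s.

Lemma fproj_ip x e : e \in s -> ip (fproj s x) e = ip x e.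
Proof.
have /orthonormalP[us os'] := os; move=> es.
rewrite /fproj linear_sumlz (bigD1_seq e) //= ipZl (os' e e) // eqxx mulr1.
rewrite big_seq_cond big1 ?addr0 // => f /andP[fs fe].
by rewrite ipZl (os' f e) // (negPf fe) mulr0.
Qed.

Lemma fprojC_ip x e : e \in s -> ip (x - fproj s x) e = 0.
Proof. by move=> es; rewrite linearBl /= fproj_ip // subrr. Qed.

Lemma fprojC_perp x y : ip (x - fproj s x) (fproj s y) = 0.
Proof. by apply: ip_eq0C; apply: fproj_perp =>
  e es; apply: ip_eq0C; exact: fprojC_ip. Qed.

Lemma fprojC_le x : rn (x - fproj s x) <= rn x.
Proof.
rewrite -[X in _ <= rn X](subrK (fproj s x)); apply: (pythagoras_le hip).
exact: fprojC_perp.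
Qed.

(** The left side is [I - fproj s] applied to [x - y], and this map is a contraction. *)
Lemma fprojC_best x y : fproj s y = y -> rn (x - fproj s x) <= rn (x - y).
Proof.
move=> sy; rewrite (_ : x - fproj s x = (x - y) - fproj s (x - y));
  first exact: fprojC_le.
by rewrite (linear_B (fproj_linear s)) sy opprB addrA subrK.
Qed.

Lemma fproj_adj x y : ip (fproj s x) y = ip x (fproj s y).
Proof.
rewrite /fproj linear_sumlz linear_sumr; apply: eq_bigr => e _ /=.
by rewrite ipZl ipZr -ip_conj mulrC.
Qed.

End Orthonormal.

(** Induction on [t]: the normalization of [w = u - fproj s u] is adjoined to [s], unless [w]
    vanishes and [u] already lies in the span. *)
Lemma GramSchmidt M (t : seq H) : subspace_set M -> (forall x, x \in t -> M x) ->
  exists s, [/\ orthonormal ip s, forall e, e \in s -> M e &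
                forall x, x \in t -> fproj s x = x].
Proof.
move=> sM; elim: t => [|u t IH] Mt; first by exists [::].
have [|s [os Ms st]] := IH; first by move=> x xt; apply: Mt; rewrite inE xt orbT.
pose w := u - fproj s u.
have Mw : M w.
  by apply: subspaceB => //; [apply: Mt; rewrite inE eqxx|exact: fproj_in].
have [w0|w0] := eqVneq w 0.
  exists s; split=> // x; rewrite inE => /predU1P[->|/st//].
  by apply/eqP; rewrite eq_sym -subr_eq0 -/w w0.
have w1 : 0 < rn w by rewrite lt_def Re_norm_eq0 w0 Re_norm_ge0.
pose e := (rn w)^-1%:C%C *: w.
have conjr : ((rn w)^-1%:C%C)^* = (rn w)^-1%:C%C.
  by rewrite conj_Creal // ger0_real // ler0c invr_ge0 ltW.
have ow f : f \in s -> ip e f = 0.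
  by move=> fs; rewrite ipZl fprojC_ip // mulr0.
have ee : ip e e = 1.
  rewrite ipZl ipZr conjr (ipE hip) -!rmorphM /= expr2.
  by rewrite mulKf ?gt_eqF // mulVf ?gt_eqF.
exists (e :: s); split.
- apply/orthonormalP; have /orthonormalP[us os'] := os; split.
    rewrite /= us andbT; apply/negP => /ow /eqP.
    by rewrite ee oner_eq0.
  have en f : f \in s -> (e == f) = false.
    by move=> fs; apply/negP => /eqP ef; have /eqP := ow _ fs; rewrite -ef ee oner_eq0.
  move=> f g; rewrite !inE => /predU1P[->|fs] /predU1P[->|gs].
  + by rewrite eqxx ee.
  + by rewrite ow // en.
  + by rewrite eq_sym en // ip_eq0C // ow.
  + exact: os'.
- by move=> f; rewrite inE => /predU1P[->|/Ms//]; exact: subspaceZ.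
move=> x; rewrite inE => /predU1P[->|xt]; rewrite /fproj big_cons -/(fproj s _).
  have -> : ip u e = (rn w)%:C%C.
    rewrite -[u](subrK (fproj s u)) -/w linearDl /= (fproj_perp (y := e)); last first.
      by move=> f fs; apply: ip_eq0C; exact: ow.
    by rewrite addr0 ipZr conjr (ipE hip) -rmorphM /= expr2 mulKf ?gt_eqF.
  by rewrite scalerA -rmorphM /= mulfV ?gt_eqF // scale1r subrK.
rewrite st // -{1}[x]st // (fproj_perp (y := e)) ?scale0r ?add0r // => f fs.
by apply: ip_eq0C; exact: ow.
Qed.

End FiniteProjection.

(** * Compact operators and finite rank approximation *)

Section FiniteRankApprox.
Context {R : realType} {H : completeNormedModType R[i]}.
Variables (ip : {dot H for Num.conj}) (hip : inner_product_norm ip).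
Implicit Types (T : H -> H) (d : R).

(** Only approximants [fproj s \o T] are used; by [fprojC_best] they are at least as good as any
    other map with values in the span of [s]. *)
Definition fin_within d T := exists s, orthonormal ip s /\
  forall x, rn x <= 1 -> rn (T x - fproj ip s (T x)) <= d.

(** Orthonormalizing [t] gives the required [s]. The first hypothesis says that [A] takes its values
    on the unit ball in the span of [t]. *)
Lemma fin_withinP d T (t : seq H) (A : H -> H) :
  (forall s, orthonormal ip s -> (forall x, x \in t -> fproj ip s x = x) ->
     forall x, rn x <= 1 -> fproj ip s (A x) = A x) ->
  (forall x, rn x <= 1 -> rn (T x - A x) <= d) -> fin_within d T.
Proof.
move=> At AT; have [//|//|s [os _ st]] := @GramSchmidt _ _ ip hip setT t.
exists s; split=> // x x1; apply: le_trans (AT x x1).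
by apply: fprojC_best => //; exact: At.
Qed.

Lemma compact_op_fin_within T d : compact_op T -> 0 < d -> fin_within d T.
Proof.
rewrite /compact_op precompactE compact_cover => cT d0.
pose K := closure (T @` closed_unit_ball H).
have [] := cT H setT (fun y => (ball y d%:C%C)^°).
- by move=> y _; exact: open_interior.
- move=> y _; exists y => //; apply: nbhs_singleton; apply: nbhs_interior.
  by apply: nbhsx_ballx; rewrite ltcR.
move=> D _ KD.
(* [A x] is a centre, taken from the finite cover, within [d] of [T x]. The default 0 lies in every
   span. *)
pose A x := xget 0 [set y | y \in finmap.enum_fset D /\ rn (T x - y) <= d].
apply: (@fin_withinP d T (finmap.enum_fset D) A).
- move=> s _ st x x1; rewrite /A; case: xgetP => [y _ [yD _]|_].
    exact: st.
  exact: (linear_0 (fproj_linear ip s)).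
- move=> x x1; have /KD[y yD] : K (T x).
    by apply: subset_closure; exists x => //; rewrite /closed_unit_ball /= Re_norm_le1.
  move=> /interior_subset; rewrite -ball_normE /= distrC Re_norm_lt => /ltW xy.
  by have [] := @xgetI _ 0 [set y | y \in finmap.enum_fset D /\ rn (T x - y) <=
    d] y (conj yD xy).
Qed.

End FiniteRankApprox.

(** * Ultrafilters and compactness from finite rank approximation *)

Section Ultrafilters.

Lemma ultra_fmap (S T : Type) (f : S -> T) (F : set_system S) :
  UltraFilter F -> UltraFilter (f @ F).
Proof.
move=> UF; split; first exact: fmap_proper_filter.
move=> G PG FG; apply/seteqP; split=> // A GA.
have [//|FA] := in_ultra_setVsetC (f @^-1` A) UF.
have : G (A `&` ~` A) by apply: filterI => //; exact: FG.
by move=> /filter_ex[x []].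
Qed.

Context {R : realType} {T : Type} (F : set_system T).
Hypothesis UF : UltraFilter F.

(** Real and imaginary parts stay in the compact segment [[-M, M]], where every ultrafilter
    converges. *)
Lemma ultra_bounded_cvg (f : T -> R[i]) (M : R) :
  F [set t | rn (f t) <= M] -> exists l, f @ F --> (l : R[i]^o).
Proof.
move=> fM.
have real (g : T -> R) : (forall t, `|g t| <= rn (f t)) ->
    exists r, forall e : R, 0 < e -> F [set t | `|r - g t| < e].
  move=> gf.
  have := @segment_compact R (- M) M; rewrite compact_ultra => /(_ (g @ F)).
  have UgF := ultra_fmap g UF; case=> // [|r [_ gr]].
    have : F [set t | `|g t| <= M] by apply: filterS fM => t /=; exact: le_trans.
    rewrite (_ : [set t | _] = g @^-1` `[- M, M]) //.
    by apply/funext => t /=; rewrite in_itv /= -ler_norml.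
  by exists r => e e0; move/cvgrPdist_lt: gr; apply.
have [|a fa] := real (fun t => complex.Re (f t)); first by move=> t; exact: ler_Re.
have [|b fb] := real (fun t => complex.Im (f t)); first by move=> t; exact: ler_Im.
exists (a +i* b)%C; apply/(@Re_norm_cvg _ R[i]^o) => e e0.
have e2 : 0 < e / 2 by rewrite divr_gt0.
apply: filterS2 (fa _ e2) (fb _ e2) => t /= ta tb.
apply: le_lt_trans (Re_norm_le_ReIm _) _.
by case: (f t) ta tb => c d /= ta tb; lra.
Qed.

End Ultrafilters.

Section FiniteRankCompact.
Context {R : realType} {H : completeNormedModType R[i]}.
Variables (ip : {dot H for Num.conj}) (hip : inner_product_norm ip).
Implicit Types (T : H -> H) (d : R).

(** Each of the finitely many coefficients is a bounded scalar function, so it converges along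
    [F]. *)
Lemma fproj_ultra_cvg (F : set_system H) (M : R) s :
  UltraFilter F -> F [set y | rn y <= M] -> exists l : H, fproj ip s @ F --> l.
Proof.
move=> UF FM; elim: s => [|e s [l IH]].
  exists 0; rewrite (_ : fproj ip [::] = cst 0); first exact: cvg_cst.
  by apply/funext => x; rewrite /fproj big_nil.
have [c ec] : exists c, (fun y => ip y e) @ F --> (c : R[i]^o).
  apply: (@ultra_bounded_cvg _ _ _ _ _ (M * rn e)).
  apply: filterS FM => y /= yM; apply: le_trans (ip_CauchySchwarz hip _ _) _.
  by rewrite ler_wpM2r ?Re_norm_ge0.
exists (c *: e + l).
rewrite (_ : fproj ip (e :: s) = (fun y => ip y e *: e + fproj ip s y)).
  by apply: cvgD => //; exact: cvgZr_tmp.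
by apply/funext => y; rewrite /fproj big_cons.
Qed.

(** An ultrafilter on the closure of the image of the ball is Cauchy: its image under [fproj ip s]
    converges, and [fproj ip s] moves points of that closure only slightly. Completeness of [H]
    concludes. *)
Lemma fin_within_compact_op T : linear T -> bounded_op T ->
  (forall d, 0 < d -> fin_within ip d T) -> compact_op T.
Proof.
move=> lT /bounded_op_pos[M M0 TM] Td; rewrite /compact_op precompactE.
set B := T @` _; rewrite compact_ultra => F UF FB.
have BB d y : 0 < d -> closure B y -> exists2 x, rn x <= 1 & rn (y - T x) < d.
  move=> d0 /(_ (ball y d%:C%C))[|_ [[x x1 <-]]]; first by apply: nbhsx_ballx;
    rewrite ltcR.
  rewrite -ball_normE /= Re_norm_lt => yx; exists x => //.
  by rewrite -Re_norm_le1.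
suff cF : cauchy F.
  have Fp : F --> lim F by exact: cauchy_cvg.
  move: (lim F) Fp => p Fp.
  exists p; split=> //.
  by apply: (@closed_cvg _ _ F _ id (closure B) (@closed_closure _ B) _ p Fp).
apply: cauchy_exP => e e0.
have [er r0] : e = (complex.Re e)%:C%C /\ 0 < complex.Re e.
  by move: e0; case: e => a b; rewrite ltcE /= => /andP[/eqP-> ->].
rewrite er; move: (complex.Re e) r0 => {er e0}e e0.
(* Three errors occur: [l - fproj ip s y], the approximation error of [T x], and the residual of
   [y - T x]. *)
have d0 : 0 < e / 3 by rewrite divr_gt0.
have [s [os sT]] := Td _ d0.
have [|l Fl] := @fproj_ultra_cvg F (M + 1) s UF.
  apply: filterS FB => y /(BB _ _ ltr01)[x x1 yx].
  rewrite /= -[y](subrK (T x)) (le_trans (Re_normD _ _)) // addrC lerD ?(ltW yx) //.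
  by rewrite (le_trans (TM x)) // -[leRHS]mulr1 ler_wpM2l // ltW.
exists l; move/Re_norm_cvg: Fl => /(_ _ d0) Fl.
apply: filterS2 FB Fl => y /(BB _ _ d0)[x x1 yx] /= ly.
rewrite -ball_normE /= Re_norm_lt.
have -> : l - y = (l - fproj ip s y) - (y - fproj ip s y).
  by rewrite opprB addrA subrK.
have -> : y - fproj ip s y = (T x - fproj ip s (T x)) +
    ((y - T x) - fproj ip s (y - T x)).
  rewrite (linear_B (fproj_linear ip s)) opprB addrACA [T x + _]addrC subrK.
  by rewrite addKr.
apply: le_lt_trans (Re_normB _ _) _.
have := Re_normD (T x - fproj ip s (T x)) ((y - T x) - fproj ip s (y - T x)).
have := fprojC_le hip os (y - T x); have := sT _ x1.
by lra.
Qed.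

End FiniteRankCompact.

(** * The weak topology and bounded functionals *)

Lemma cvg_initial_topology (S : choiceType) (T : topologicalType) (f : S -> T)
    (F : set_system S) (s : S) : Filter F ->
  f @ F --> f s -> F --> (s : initial_topology f).
Proof.
move=> FF fs A; rewrite [nbhs]/nbhs /= => -[_ [[B Bop <-] Bs BA]].
by apply: filterS BA _; apply: fs; exact: open_nbhs_nbhs.
Qed.

Section WeakTopology.
Context {R : realType} {V : normedModType R[i]}.

(** The weak topology is initial for the evaluation into a pointwise topology, which is itself a
    supremum of initial topologies for the coordinates. Each direction goes through these two
    layers. *)
Lemma weak_cvgP (F : set_system V) (p : V) : Filter F ->
  (F --> (p : weak V)) <-> forall phi : cdual V, sval phi @ F --> (sval phi p : R[i]^o).
Proof.
move=> FF; split=> [Fp phi|Fp].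
  have c : {for (p : weak V), continuous (@cdual_eval _ V : weak V -> _)}.
    exact: initial_continuous.
  have Fe : @cdual_eval _ V @ F --> (@cdual_eval _ V p : {ptws cdual V -> R[i]^o}).
    exact: cvg_trans (cvg_app _ Fp) c.
  have FFe : Filter (@cdual_eval _ V @ F) by exact: fmap_filter.
  have {}Fe := (@cvg_sup _ _ _ _ _ FFe).1 Fe phi.
  pose ev (f : cdual V -> R[i]^o) := f phi.
  apply: cvg_trans (cvg_app ev Fe) _.
  exact: (@initial_continuous _ _ ev (@cdual_eval _ V p)).
apply: cvg_initial_topology; apply/cvg_sup => phi.
by apply: cvg_initial_topology; exact: Fp.
Qed.

Lemma bounded_cdual (f : V -> R[i]) (M : R) :
  (forall c x y, f (c *: x + y) = c * f x + f y) ->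
  (forall x, rn (f x) <= M * rn x) -> exists phi : cdual V, forall x, sval phi x = f x.
Proof.
move=> lf bf.
have lf' : GRing.linear_for *%R f by move=> c x y; exact: lf.
pose g : {scalar V} := HB.pack f (GRing.isLinear.Build _ _ _ _ f lf').
have cg : continuous (g : V -> R[i]^o).
  apply: (@Re_norm_lipschitz_continuous _ _ R[i]^o _ M) => x y.
  by rewrite -raddfB; exact: bf.
by exists (exist _ g cg).
Qed.

(** Continuity at 0 gives a radius [r] with [|phi| < 1] on the ball of radius [r]; rescaling [x] to
    norm [r / 2] gives the constant [2 / r]. *)
Lemma cdual_bounded (phi : cdual V) :
  exists2 M : R, 0 < M & forall x, rn (sval phi x) <= M * rn x.
Proof.
case: phi => f cf; change (sval _) with f.
have /(@Re_norm_cvg _ R[i]^o)/(_ _ ltr01)/nbhs_ballP[e] := cf 0; rewrite raddf0 => e0 eb.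
have [er r0] : e = (complex.Re e)%:C%C /\ 0 < complex.Re e.
  by move: (e0 : 0 < e); case: (e) => a b; rewrite ltcE => /andP[/eqP /= -> ->].
move: er eb; move: (complex.Re e) r0 => r r0 -> eb.
exists (2 / r) => [|x]; first by rewrite divr_gt0.
have [->|x0] := eqVneq x 0; first by rewrite raddf0 !normr0 mulr0.
have x1 : 0 < rn x by rewrite lt_def Re_norm_eq0 x0 Re_norm_ge0.
have c0 : 0 <= r / 2 / rn x by rewrite !divr_ge0 // ltW.
have : ball 0 r%:C%C ((r / 2 / rn x)%:C%C *: x).
  rewrite -ball_normE /ball_ /= sub0r normrN Re_norm_lt Re_normZr //.
  by rewrite divfK ?gt_eqF //; lra.
move=> /eb; rewrite -[X in X ->
  _]/(is_true (rn (0 - f _) < 1)) sub0r normrN linearZ Re_normcM.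
rewrite Re_normc_real // => /ltW.
rewrite -ler_pdivlMl ?divr_gt0 // mulr1 => /le_trans; apply.
by rewrite invf_div [_ / (r / 2)]mulrC invf_div.
Qed.

End WeakTopology.

Section OperatorNormBounds.
Context {R : realType} {V W : normedModType R[i]} (f : V -> W).

Lemma ler_opnorm x : linear f -> bounded_op f -> rn (f x) <= opnorm f * rn x.
Proof.
move=> lf bf; have [->|x0] := eqVneq x 0.
  by rewrite linear_0 // !Re_norm0 mulr0.
have x1 : 0 < rn x by rewrite lt_def Re_norm_eq0 x0 Re_norm_ge0.
have := @opnorm_ub _ _ _ f ((rn x)^-1%:C%C *: x) bf.
rewrite Re_norm_le1 (linear_Z lf) !Re_normZr ?invr_ge0 ?Re_norm_ge0 //.
by rewrite mulVf ?gt_eqF // lexx ler_pdivrMl // mulrC; apply.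
Qed.

Lemma opnorm_le_bound (M : R) : 0 <= M -> (forall x, rn (f x) <= M * rn x) ->
  opnorm f <= M.
Proof.
move=> M0 fM; apply: opnorm_le => x; rewrite Re_norm_le1 => x1.
by rewrite (le_trans (fM x)) // -[leRHS]mulr1 ler_wpM2l.
Qed.

End OperatorNormBounds.

(** * Weak operator topology on the unit ball *)

Section NestAlgebraBasics.
Context {R : realType} {H : normedModType R[i]} (N : nest H).
Implicit Types (y z : nest_alg N).

Lemma nest_alg_linear z : linear z.
Proof. by have [] := nest_algP z. Qed.

Lemma nest_alg_bounded z : bounded_op z.
Proof. by have [] := nest_algP z. Qed.

Lemma nest_alg_inv z P x : N P -> P x -> P (z x).
Proof. by move=> NP Px; have [_ _ zN] := nest_algP z; apply: (zN P NP); exists x. Qed.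

Lemma nest_algDE y z x : (y + z) x = y x + z x. Proof. by []. Qed.

Lemma nest_algZE c z x : (c *: z) x = c *: z x. Proof. by []. Qed.

Lemma nest_algBE y z x : (y - z) x = y x - z x. Proof. by []. Qed.

Lemma nest_alg_le z x : rn (z x) <= rn z * rn x.
Proof. by apply: ler_opnorm; [exact: nest_alg_linear|exact: nest_alg_bounded]. Qed.

Lemma nest_alg_norm_le z (M : R) : 0 <= M ->
  (forall x, rn (z x) <= M * rn x) -> rn z <= M.
Proof. exact: opnorm_le_bound. Qed.

End NestAlgebraBasics.

Lemma cvg_lincomb {R : realType} (T : Type) (F : set_system T)
    (f g : T -> R[i]) (c p q : R[i]) : Filter F ->
  f @ F --> (p : R[i]^o) -> g @ F --> (q : R[i]^o) ->
  (fun t => c * f t + g t) @ F --> (c * p + q : R[i]^o).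
Proof.
move=> FF /(@Re_norm_cvg _ R[i]^o) fp /(@Re_norm_cvg _ R[i]^o) gq.
apply/(@Re_norm_cvg _ R[i]^o) => e e0.
have c1 : 0 < rn c + 1 by rewrite ltr_wpDl ?Re_normc_ge0.
have e1 : 0 < e / 2 / (rn c + 1) by rewrite !divr_gt0.
have e2 : 0 < e / 2 by rewrite divr_gt0.
apply: filterS2 (fp _ e1) (gq _ e2) => t.
rewrite -[_ t]/(is_true (_ < _)) -[X in _ -> X -> _]/(is_true (_ < _)).
rewrite ltr_pdivlMr // => ft gt; rewrite -[_ t]/(is_true (_ < _)).
rewrite (_ : _ - _ = c * (p - f t) + (q - g t)); last by ring.
apply: le_lt_trans (Re_normcD _ _) _; rewrite Re_normcM.
have : rn c * rn (p - f t) <= rn (p - f t) * (rn c + 1).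
  by rewrite mulrC ler_wpM2l ?Re_normc_ge0 // lerDl.
move: ft gt; set u := rn (p - f t); set v := rn (q - g t).
move: (rn c * u) (u * _) => x y; lra.
Qed.

Section WeakOperatorCompactness.
Context {R : realType} {H : completeNormedModType R[i]}.
Variables (ip : {dot H for Num.conj}) (hip : inner_product_norm ip).
Variable N : nest H.

Definition wot_cvg (F : set_system (nest_alg N)) (z0 : nest_alg N) :=
  forall u v, (fun z : nest_alg N => ip (z u) v) @ F --> (ip (z0 u) v : R[i]^o).

(** The limits [l (u, v)] of [ip (z u) v] along [F] form a bounded sesquilinear form, which Riesz
    representation turns into an operator of norm at most 1. *)
Lemma unit_ball_wot_compact (F : set_system (nest_alg N)) : UltraFilter F ->
  F [set z : nest_alg N | rn z <= 1] ->
  exists2 z0 : nest_alg N, rn z0 <= 1 & wot_cvg F z0.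
Proof.
move=> UF F1.
have zle (z : nest_alg N) u v : rn z <= 1 -> rn (ip (z u) v) <= rn u * rn v.
  move=> z1; apply: le_trans (ip_CauchySchwarz hip _ _) _.
  rewrite ler_wpM2r ?Re_norm_ge0 // (le_trans (nest_alg_le z u)) //.
  by rewrite -[leRHS]mul1r ler_wpM2r ?Re_norm_ge0.
have /choice[l lF] (p : H * H) : exists c : R[i],
    (fun z : nest_alg N => ip (z p.1) p.2) @ F --> (c : R[i]^o).
  apply: (@ultra_bounded_cvg _ _ _ _ _ (rn p.1 * rn p.2)).
  by apply: filterS F1 => z; exact: zle.
have luniq (f : nest_alg N -> R[i]) (c d : R[i]) :
    f @ F --> (c : R[i]^o) -> f @ F --> (d : R[i]^o) -> c = d.
  by apply: (@cvg_unique R[i]^o); exact: norm_hausdorff.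
have lle u v : rn (l (u, v)) <= rn u * rn v.
  apply/ler_addgt0Pr => e e0.
  have /(@Re_norm_cvg _ R[i]^o)/(_ _ e0) lFe := lF (u, v).
  have [z [/= z1 ze]] := filter_ex (filterI F1 lFe).
  rewrite -[l (u, v)](subrK (ip (z u) v)) (le_trans (Re_normcD _ _)) //
    addrC lerD ?(ltW ze) //.
  exact: zle.
(* The form is conjugate linear in [v], so Riesz is applied to its conjugate. *)
have /choice[T TE] (u : H) : exists h, forall v, l (u, v) = ip h v.
  have [c v w|v|h hP] := @Riesz_representation _ _ ip hip (fun v =>
    (l (u, v))^* : R[i]^o) (rn u).
  - change ((l (u, c *: v + w)%R)^* = c * (l (u, v))^* + (l (u, w))^*).
    rewrite -[c in RHS]conjCK -rmorphM -rmorphD; congr (_^*).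
    apply: luniq (lF _) _.
    rewrite /= (_ : (fun z : nest_alg N => ip (z u) (c *: v + w)) =
      (fun z => c^* * ip (z u) v + ip (z u) w)).
      exact: (cvg_lincomb _ (lF (u, v)) (lF (u, w))).
    by apply/funext => z /=; rewrite linearDr /= ipZr.
  - by rewrite Re_norm_conj lle.
  - by exists h => v; rewrite ip_conj -hP conjCK.
have lT : linear T.
  move=> c u v; apply: (@ip_inj _ _ ip) => w; rewrite linearDl /= ipZl -!TE.
  apply: luniq (lF _) _.
  rewrite /= (_ : (fun z : nest_alg N => ip (z (c *: u + v)) w) =
    (fun z => c * ip (z u) w + ip (z v) w)).
    exact: (cvg_lincomb _ (lF (u, w)) (lF (v, w))).
  by apply/funext => z /=; rewrite (nest_alg_linear z) linearDl /= ipZl.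
have T1 u : rn (T u) <= 1 * rn u.
  rewrite mul1r; apply: (rn_le_ip hip); first exact: Re_norm_ge0.
  move=> v v1; rewrite -TE (le_trans (lle _ _)) // -[leRHS]mulr1.
  by rewrite ler_wpM2l ?Re_norm_ge0.
have TN : T \in nest_alg_pred N.
  apply/mem_set; split=> //; first by exists 1.
  move=> P NP _ [x Px <-]; have cP := nest_subspace NP.
  (* [w] is the part of [T x] outside [P]. It is orthogonal to every [z x], which stays in [P],
     hence to the limit [T x], which forces [w = 0]. *)
  pose w := orth_projC ip P (T x).
  have Tw : ip (T x) w = 0.
    rewrite -TE; apply: luniq (lF _) _; rewrite /= (_ : (fun z :
      nest_alg N => ip (z x) w) = cst 0); first exact: (@cvg_cst R[i]^o).
    apply/funext => z /=; apply: ip_eq0C; apply: (orth_projC_ip hip cP).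
    exact: nest_alg_inv.
  have : ip w w = 0.
    rewrite {1}/w /orth_projC linearBl /= Tw sub0r.
    by rewrite [ip _ _]ip_eq0C ?oppr0 // (orth_projC_ip hip cP) //; exact: orth_proj_in.
  move/eqP; rewrite dnorm_eq0 subr_eq0 => /eqP ->.
  exact: (orth_proj_in hip cP).
exists (NestAlg TN); first exact: nest_alg_norm_le.
by move=> u v; rewrite -TE; exact: lF.
Qed.

End WeakOperatorCompactness.

(** * A Mazur type argument and weak compactness *)

Section Mazur.
Context {R : realType} {E : lmodType R[i]} (B : E -> E -> R).
Hypotheses (BC : forall x y, B x y = B y x)
  (BD : forall x y z, B (x + y) z = B x z + B y z)
  (BZ : forall (r : R) x y, B (r%:C%C *: x) y = r * B x y)
  (B0 : forall x, 0 <= B x x).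

(* Moving a near-minimizer z0 of B z z over Z towards a point z with B z0 z
   small would decrease B z0 z0, unless the infimum vanishes. *)
Lemma convex_weakly_null_small (Z : set E) (F : set_system E) (C : R) :
  ProperFilter F -> F Z ->
  (forall x y (t : R), 0 <= t <= 1 -> Z x -> Z y -> Z (x + t%:C%C *: (y - x))) ->
  (forall x, Z x -> B x x <= C) ->
  (forall z0 (e : R), 0 < e -> F [set z | `|B z0 z| < e]) ->
  forall e : R, 0 < e -> exists2 z, Z z & B z z < e.
Proof.
move=> PF FZ convZ ZC Fnull e e0; apply: contrapT => noz.
have Ze z : Z z -> e <= B z z.
  by move=> Zz; rewrite leNgt; apply/negP => Bz; apply: noz; exists z.
have [z1 Zz1] := filter_ex FZ.
have C0 : 0 < C by apply: lt_le_trans e0 (le_trans (Ze _ Zz1) (ZC _ Zz1)).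
pose D := inf [set B z z | z in Z].
have infD : has_inf [set B z z | z in Z].
  by split; [exists (B z1 z1), z1|exists 0 => _ [z _ <-]].
have De : e <= D.
  by apply: lb_le_inf => [|_ [z Zz <-]]; [exact: infD.1|exact: Ze].
have DB z : Z z -> D <= B z z.
  by move=> Zz; apply: ge_inf; [exact: infD.2|exists z].
(* Write [p], [q], [r] for [B z0 z], [B z0 z0], [B z z]. Minimality up to [t ^+ 2] at
   [z0 + t (z - z0)] gives [2 (q - p) <= t (1 + r - 2 p + q)], and the right side is at most
   [t (1 + 2 C + e) = e]. As [p < e / 4], this contradicts [e <= q]. *)
pose t := e / (1 + 2 * C + e).
have k0 : 0 < 1 + 2 * C + e by lra.
have t0 : 0 < t by rewrite divr_gt0.
have t1 : t <= 1 by rewrite /t ler_pdivrMr // mul1r; lra.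
have tk : t * (1 + 2 * C + e) = e by rewrite /t divfK // gt_eqF.
have [_ [z0 Zz0 <-] z0D] := inf_adherent (exprn_gt0 2 t0) infD.
have e4 : 0 < e / 4 by rewrite divr_gt0.
have [z [Zz /= z0z]] := filter_ex (filterI FZ (Fnull z0 _ e4)).
have BN x y : B (- x) y = - B x y.
  by have := BZ (-1) x y; rewrite rmorphN1 scaleN1r mulN1r.
have BDr x y w : B w (x + y) = B w x + B w y by rewrite BC BD !(BC w).
have BZr r x y : B x (r%:C%C *: y) = r * B x y by rewrite BC BZ BC.
have BNr x y : B x (- y) = - B x y by rewrite BC BN BC.
have := DB _ (convZ z0 z t _ Zz0 Zz); rewrite ltW //= t1 => /(_ isT).
rewrite !(BD, BDr, BZ, BZr, BN, BNr) (BC z z0).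
have := ZC _ Zz; have := ZC _ Zz0; move: z0z z0D; rewrite -/D ltr_norml => /andP[].
set p := B z0 z; set q := B z0 z0; set r := B z z => p1 p2 qD q1 r1 h.
have h1 : 2 * (q - p) <= t * (1 + 2 * C + e).
  have : t * (2 * (q - p)) <= t * (t * (1 + 2 * C + e)).
    have : t * (t * (r - 2 * p + q)) <= t * (t * (2 * C + e)).
      by rewrite !ler_pM2l //; lra.
    by move: h qD; rewrite expr2; nra.
  by rewrite ler_pM2l.
by have := DB _ Zz0; rewrite -/q; lra.
Qed.

End Mazur.

Lemma sum_sqr_le {R : realType} (I : Type) (s : seq I) (F : I -> R) (r : R) :
  (forall i, 0 <= F i) -> 0 <= r -> \sum_(i <- s) F i ^+ 2 <= r ^+ 2 ->
  \sum_(i <- s) F i <= (size s)%:R * r.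
Proof.
move=> F0 r0; elim: s => [|i s IH]; first by rewrite !big_nil mul0r.
rewrite !big_cons => h; rewrite -[(size _)%:R]/((size s).+1%:R) -natr1 mulrDl mul1r addrC.
have S0 : 0 <= \sum_(i <- s) F i ^+ 2 by apply: sumr_ge0 => j _; exact: sqr_ge0.
apply: lerD; first by apply: IH; apply: le_trans h; rewrite lerDr sqr_ge0.
by rewrite -(@ler_pXn2r _ 2) ?nnegrE // (le_trans _ h) // lerDl.
Qed.

Section WeakCompactness.
Context {R : realType} {H : completeNormedModType R[i]}.
Variables (ip : {dot H for Num.conj}) (hip : inner_product_norm ip).
Variable N : nest H.
Implicit Types (z : nest_alg N) (T : nest_alg N -> nest_alg N).

(* Only real scalars are required, because z |-> adjoint z e is conjugate linear *)
Definition wot_probe (rho : nest_alg N -> H) : Prop :=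
  [/\ forall y z, rho (y + z) = rho y + rho z,
      forall (r : R) z, rho (r%:C%C *: z) = r%:C%C *: rho z,
      exists C : R, forall z, rn (rho z) <= C * rn z &
      forall F : set_system (nest_alg N), ProperFilter F -> wot_cvg ip F 0 ->
        forall v, (fun z => ip (rho z) v) @ F --> (0 : R[i]^o)].

(** The radius is 2 because the estimate is applied to differences of two elements of the unit
    ball. *)
Definition wot_controlled (f : nest_alg N -> nest_alg N) : Prop :=
  forall d : R, 0 < d -> exists (I : Type) (rho : I -> nest_alg N -> H) (s : seq I),
    (forall i, wot_probe (rho i)) /\
    forall z, rn z <= 2 -> rn (f z) <= \sum_(i <- s) rn (rho i z) + d.

(** Suppose the limit [c] of [phi (f z)] is nonzero. The [z] of norm at most 2 with [phi (f z)] near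
    [c] form a convex set belonging to [F], so the Mazur argument finds in it a [z] with all probes
    small. Then [f z] is small, and so is [phi (f z)], a contradiction. *)
Lemma wot_controlled_null (f : nest_alg N -> nest_alg N) (phi : cdual (nest_alg N))
    (F : set_system (nest_alg N)) (K : R) :
  linear f -> (forall z, rn (f z) <= K * rn z) ->
  wot_controlled f -> UltraFilter F -> F [set z | rn z <= 2] -> wot_cvg ip F 0 ->
  (fun z => sval phi (f z)) @ F --> (0 : R[i]^o).
Proof.
move=> lf fK cf UF F2 F0; have [M M0 phiM] := cdual_bounded phi.
pose g z := sval phi (f z).
have gZ (c : R[i]) z : g (c *: z) = c * g z by rewrite /g (linear_Z lf) linearZ.
have gD y z : g (y + z) = g y + g z by rewrite /g (linear_D lf) raddfD.
have [c gc] : exists c, g @ F --> (c : R[i]^o).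
  apply: (@ultra_bounded_cvg _ _ _ _ _ (M * (`|K| * 2))).
  apply: filterS F2 => z /= z2; apply: le_trans (phiM _) _.
  rewrite ler_wpM2l ?(ltW M0) // (le_trans (fK z)) //.
  by rewrite (le_trans (ler_wpM2r (Re_norm_ge0 _) (ler_norm K))) // ler_wpM2l.
suff c0 : c = 0 by move: gc; rewrite c0.
apply/eqP; apply: contrapT => /negP c0.
have r0 : 0 < rn c by rewrite lt_def (@Re_norm_eq0 _ R[i]^o) c0 Re_normc_ge0.
have [r rE] : exists r, rn c = r by exists (rn c).
rewrite rE in r0.
pose Z := [set z | rn z <= 2 /\ rn (g z - c) <= r / 2].
have FZ : F Z.
  have r2 : 0 < r / 2 by rewrite divr_gt0.
  have /(@Re_norm_cvg _ R[i]^o)/(_ _ r2) gr := gc.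
  apply: filterS2 F2 gr => z z2 zr; split=> //.
  by rewrite -normrN opprB ltW.
(* The probe sum and the error [d] will each contribute at most [r / (8 * M)], so that
   [rn (g z) <= r / 4], whereas [rn (g z) >= r / 2] on [Z]. *)
have d0 : 0 < r / (8 * M) by rewrite divr_gt0 // mulr_gt0.
have [I [rho [s [rhoP fs]]]] := cf _ d0.
(* A real inner product form is taken, since probes are only real-homogeneous. *)
pose B y z : R := \sum_(i <- s) complex.Re (ip (rho i y) (rho i z)).
have BE z : B z z = \sum_(i <- s) rn (rho i z) ^+ 2.
  by apply: eq_bigr => i _; rewrite (ipE hip).
pose k := r / (8 * M) / ((size s)%:R + 1).
have s1 : 0 < (size s)%:R + 1 :> R by rewrite ltr_wpDl.
have k0 : 0 < k by rewrite divr_gt0.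
have [C CP] : exists C, forall z, Z z -> B z z <= C.
  have /choice[Cf CfP] (i : I) : exists C : R, forall z, rn (rho i z) <= C * rn z.
    by have [] := rhoP i.
  exists (\sum_(i <- s) (`|Cf i| * 2) ^+ 2) => z [z2 _]; rewrite BE.
  apply: ler_sum => i _; rewrite ler_pXn2r ?nnegrE ?mulr_ge0 ?Re_norm_ge0 //.
  apply: le_trans (CfP _ _) _; apply: (@le_trans _ _ (`|Cf i| * rn z)).
    by rewrite ler_wpM2r ?Re_norm_ge0 ?ler_norm.
  by rewrite ler_wpM2l.
have [|||||||z [z2 zc]] := @convex_weakly_null_small R (nest_alg N) B _ _ _ _ Z
  F C _ FZ _ CP _ (k ^+ 2).
- by move=> y z; apply: eq_bigr => i _; rewrite Re_ipC.
- move=> x y z; rewrite /B -big_split; apply: eq_bigr => i _ /=.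
  by have [-> _ _ _] := rhoP i; rewrite linearDl /= ReD.
- move=> t x y; rewrite /B mulr_sumr; apply: eq_bigr => i _ /=.
  by have [_ -> _ _] := rhoP i; rewrite ipZl ReZ.
- by move=> x; rewrite BE sumr_ge0 // => i _; exact: sqr_ge0.
- move=> x y t /andP[t0 t1] [x2 xc] [y2 yc].
  have t1' : 0 <= 1 - t by rewrite subr_ge0.
  have xE : x + t%:C%C *: (y - x) = (1 - t)%:C%C *: x + t%:C%C *: y.
    by rewrite rmorphB rmorph1 scalerBl scalerBr scale1r addrA addrAC.
  split.
    rewrite xE (le_trans (Re_normD _ _)) // !Re_normZr //.
    have : (1 - t) * rn x <= (1 - t) * 2 by rewrite ler_wpM2l.
    have : t * rn y <= t * 2 by rewrite ler_wpM2l.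
    by lra.
  rewrite /= xE gD !gZ (_ : _ - c =
    (1 - t)%:C%C * (g x - c) + t%:C%C * (g y - c)); last first.
    by rewrite rmorphB rmorph1; ring.
  rewrite (le_trans (Re_normcD _ _)) // !Re_normcM !Re_normc_real //.
  have : (1 - t) * rn (g x - c) <= (1 - t) * (r / 2) by rewrite ler_wpM2l.
  have : t * rn (g y - c) <= t * (r / 2) by rewrite ler_wpM2l.
  by lra.
- move=> z0; rewrite /B; elim: s {fs BE k s1 k0 CP B} => [|i s IH] e e0.
    by apply: filterE => z; rewrite /= big_nil normr0.
  have e2 : 0 < e / 2 by rewrite divr_gt0.
  have [_ _ _ /(_ F _ F0 (rho i z0))] := rhoP i.
  move=> /(@Re_norm_cvg _ R[i]^o)/(_ _ e2) ie.
  apply: filterS2 ie (IH _ e2) => z /= iz sz; rewrite big_cons.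
  apply: le_lt_trans (ler_normD _ _) _; rewrite [e]splitr ltrD //.
  by rewrite Re_ipC (le_lt_trans (ler_Re _)) // -normrN -sub0r.
- by rewrite exprn_gt0.
rewrite BE => /ltW /(sum_sqr_le (fun i => Re_norm_ge0 _) (ltW k0)) sk.
have gz : rn (g z) <= r / 4.
  apply: le_trans (phiM _) _.
  have -> : r / 4 = M * (r / (8 * M) + r / (8 * M)).
    by field; rewrite gt_eqF.
  rewrite ler_pM2l // (le_trans (fs _ z2)) // lerD2r (le_trans sk) //.
  by rewrite /k mulrCA ler_piMr ?(ltW d0) // ler_pdivrMr // mul1r lerDl.
have := Re_normcB (g z) (g z - c); rewrite opprB addrC subrK rE.
by lra.
Qed.

(** The functionals [ip (z u) v] of [z] separate the points of the nest algebra. *)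
Lemma weak_nest_alg_hausdorff : hausdorff_space (weak (nest_alg N)).
Proof.
move=> p q pq; apply/val_inj/funext => u; apply: (@ip_inj _ _ ip) => v.
have [c x y|z|phi phiE] := @bounded_cdual _ (nest_alg N) (fun z =>
  ip (z u) v) (rn u * rn v).
- by rewrite linearDl /= ipZl.
- apply: le_trans (ip_CauchySchwarz hip _ _) _.
  by rewrite [leRHS]mulrAC ler_wpM2r ?Re_norm_ge0 // [leRHS]mulrC nest_alg_le.
rewrite -!phiE; apply/eqP; rewrite -subr_eq0; apply: contrapT => /negP pq0.
have e0 : 0 < rn (sval phi p - sval phi q) / 2.
  by rewrite divr_gt0 // lt_def (@Re_norm_eq0 _ R[i]^o) pq0 Re_normc_ge0.
have nb (z : weak (nest_alg N)) :
  nbhs z [set y | rn (sval phi z - sval phi y) < rn (sval phi p - sval phi q) / 2].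
  have /weak_cvgP/(_ phi)/(@Re_norm_cvg _ R[i]^o) : id @ nbhs z --> z by exact: cvg_id.
  exact.
have [y [py qy]] := pq _ _ (nb p) (nb q).
have {}py : rn (sval phi p - sval phi y) < rn (sval phi p - sval phi q) / 2 by exact: py.
have {}qy : rn (sval phi q - sval phi y) < rn (sval phi p - sval phi q) / 2 by exact: qy.
have := Re_normcB (sval phi p - sval phi y) (sval phi q - sval phi y).
rewrite opprB addrA subrK.
by lra.
Qed.

(** An ultrafilter on the image of the unit ball is lifted to the ball by a section [s] of [f],
    where it has a weak operator limit [z0]; [wot_controlled_null] applied to [s y - z0] shows that
    [f z0] is the weak limit of the original ultrafilter. *)
Lemma wot_controlled_weakly_compact (f : nest_alg N -> nest_alg N) (K : R) :
  linear f -> (forall z, rn (f z) <= K * rn z) -> wot_controlled f ->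
  weakly_compact_op f.
Proof.
move=> lf fK cf; apply: (compact_precompact weak_nest_alg_hausdorff).
rewrite compact_ultra => F UF FA; set A := (X in F X) in FA *.
have /choice[s sP] (y : nest_alg N) : exists z, A y -> rn z <= 1 /\ f z = y.
  have [[z z1 <-]|nA] := pselect (A y); last by exists 0 => /nA.
  by exists z => _; split=> //; rewrite -Re_norm_le1.
have UG := ultra_fmap s UF.
have [|z0 z01 Gz0] := @unit_ball_wot_compact _ _ ip hip N (s @ F) UG.
  by apply: (@filterS _ F _ A [set y | rn (s y) <= 1]) => // y /sP[].
exists (f z0); split; first by exists z0 => //; rewrite /closed_unit_ball /= Re_norm_le1.
apply/weak_cvgP => phi; apply/(@Re_norm_cvg _ R[i]^o) => e e0.
have Uh := ultra_fmap (fun y => s y - z0) UF.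
have := @wot_controlled_null f phi ((fun y => s y - z0) @ F) K lf fK cf Uh.
case/(_ _ _)/wrap => [|u v|/(@Re_norm_cvg _ R[i]^o)/(_ _ e0)].
- apply: (@filterS _ F _ A [set y | rn (s y - z0) <= 2]) => // y /sP[y1 _].
  by rewrite /mkset (le_trans (Re_normB _ _)) // -[2]/(1 + 1) lerD.
- apply/(@Re_norm_cvg _ R[i]^o) => {}e {}e0.
  have /(@Re_norm_cvg _ R[i]^o)/(_ _ e0) := Gz0 u v.
  apply: (@filterS _ F _ [set y | rn (ip (z0 u) v - ip (s y u) v) < e]
    [set y | rn (ip ((0 : nest_alg N) u) v - ip ((s y - z0) u) v) < e]) => y.
  rewrite /mkset nest_algBE linearBl [ip ((0 : nest_alg N) u) v]linear0l.
  by rewrite sub0r opprB.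
move=> h; apply: (@filterS2 _ F _ A [set y | rn (0 - sval phi (f (s y - z0))) <
  e] _ _ FA h) => y /sP[_ yE].
rewrite /mkset sub0r normrN (linear_B lf) yE raddfB.
by rewrite -normrN opprB.
Qed.

End WeakCompactness.

Section Composition.
Context {R : realType} {U V W : normedModType R[i]}.

Lemma linear_comp (f : V -> W) (g : U -> V) : linear f -> linear g -> linear (f \o g).
Proof. by move=> lf lg c x y; rewrite /= lg lf. Qed.

Lemma bounded_op_comp (f : V -> W) (g : U -> V) :
  bounded_op f -> bounded_op g -> bounded_op (f \o g).
Proof.
move=> [M fM] [M' gM]; exists (`|M| * M') => x.
apply: (le_trans (fM _)); apply: (@le_trans _ _ (`|M| * rn (g x))).
  by rewrite ler_wpM2r ?Re_norm_ge0 ?ler_norm.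
by rewrite -mulrA ler_wpM2l.
Qed.

End Composition.

(** * Sufficiency *)

Section Sufficiency.
Context {R : realType} {H : completeNormedModType R[i]}.
Variables (ip : {dot H for Num.conj}) (hip : inner_product_norm ip).
Variable N : nest H.
Implicit Types (z a b : nest_alg N) (P : set H).

Lemma orth_proj_bounded P : closed_subspace P -> bounded_op (orth_proj ip P).
Proof. by move=> cP; exists 1 => x; rewrite mul1r; exact: orth_proj_le. Qed.

Lemma orth_projC_bounded P : closed_subspace P -> bounded_op (orth_projC ip P).
Proof. by move=> cP; exists 1 => x; rewrite mul1r; exact: orth_projC_le. Qed.

Lemma wot_probe_vector (A : H -> H) (e : H) : linear A -> bounded_op A ->
  wot_probe ip (fun z : nest_alg N => A (z e)).
Proof.
move=> lA bA; split=> [y z|r z||F PF F0 v].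
- by rewrite nest_algDE (linear_D lA).
- by rewrite nest_algZE (linear_Z lA).
- have [M M0 AM] := bounded_op_pos bA; exists (M * rn e) => z.
  by rewrite (le_trans (AM _)) // -mulrA ler_wpM2l ?(ltW M0) // mulrC nest_alg_le.
have := F0 e (adjoint ip A v); rewrite [ip ((0 : nest_alg N) e) _]linear0l.
rewrite (_ : (fun z : nest_alg N => ip (z e) (adjoint ip A v)) = (fun z =>
  ip (A (z e)) v)) //.
by apply/funext => z; rewrite (adjointE hip lA bA).
Qed.

(** Its inner product with [v] is the conjugate of [ip (z (B v)) (adjoint ip A e)], hence it tends
    to 0 under weak operator convergence to 0. *)
Lemma wot_probe_adjoint (A B : H -> H) (e : H) :
  linear A -> bounded_op A -> linear B -> bounded_op B ->
  wot_probe ip (fun z : nest_alg N => adjoint ip (A \o z \o B) e).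
Proof.
move=> lA bA lB bB.
have lT (z : nest_alg N) : linear (A \o z \o B).
  by apply: linear_comp => //; apply: linear_comp => //; exact: nest_alg_linear.
have bT (z : nest_alg N) : bounded_op (A \o z \o B).
  by apply: bounded_op_comp => //; apply: bounded_op_comp => //; exact: nest_alg_bounded.
split=> [y z|r z||F PF F0 v].
- apply: (adjoint_uniq hip (lT _) (bT _)) => x.
  rewrite linearDr /= -!(adjointE hip (lT _) (bT _)) -linearDl /=.
  by rewrite -(linear_D lA).
- apply: (adjoint_uniq hip (lT _) (bT _)) => x.
  rewrite ipZr -(adjointE hip (lT _) (bT _)).
  rewrite -[LHS]/(ip (A (r%:C%C *: z (B x))) e) (linear_Z lA) ipZl.
  by congr (_ * _); rewrite conj_Creal // complex_real.
- have [M M0 AM] := bounded_op_pos bA; have [K K0 BK] := bounded_op_pos bB.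
  exists (M * K * rn e) => z; rewrite mulrAC; apply: (adjoint_le hip) => //.
    by rewrite !mulr_ge0 ?Re_norm_ge0 // ltW.
  move=> x; rewrite (le_trans (AM _)) // mulrAC -!mulrA ler_wpM2l ?(ltW M0) //.
  by rewrite (le_trans (nest_alg_le _ _)) // mulrA [leRHS]mulrC ler_wpM2l ?Re_norm_ge0.
have := F0 (B v) (adjoint ip A e); rewrite [ip ((0 : nest_alg N) _) _]linear0l.
move=> /(@Re_norm_cvg _ R[i]^o) h; apply/(@Re_norm_cvg _ R[i]^o) => d d0.
apply: filterS (h _ d0) => z; rewrite /mkset !sub0r !normrN.
by rewrite -(adjointE hip lA bA) [ip (adjoint _ _ _) _]ip_conj -(adjointE hip
  (lT _) (bT _)) Re_norm_conj.
Qed.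

Lemma mul_op_linear a b : linear (mul_op a b).
Proof.
move=> c y z; apply/val_inj/funext => x.
exact: (nest_alg_linear a c (y (b x)) (z (b x))).
Qed.

Lemma mul_op_le a b z : rn (mul_op a b z) <= rn a * rn b * rn z.
Proof.
apply: nest_alg_norm_le; first by rewrite !mulr_ge0 ?Re_norm_ge0.
move=> x; rewrite -!mulrA; apply: (le_trans (nest_alg_le a (z (b x)))).
rewrite ler_wpM2l ?Re_norm_ge0 // (le_trans (nest_alg_le z (b x))) //.
by rewrite [leRHS]mulrCA ler_wpM2l ?Re_norm_ge0 // nest_alg_le.
Qed.

(** In [a z b = a P z b + a P~ z P~ b], the first term is nearly determined by its coordinates along
    a finite [s], and in the second [P~ b] nearly takes values in the span of a finite [t]. Both
    yield finitely many probes in [z]. *)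
Lemma mul_op_weakly_compact a b :
  (forall d : R, 0 < d -> exists P, [/\ N P,
     fin_within ip d (a \o orth_proj ip P) & fin_within ip d (orth_projC ip P \o b)]) ->
  weakly_compact_op (mul_op a b).
Proof.
move=> ab; apply: (wot_controlled_weakly_compact hip (@mul_op_linear a b)
  (@mul_op_le a b)).
(* As [|z| <= 2], approximation within [d / k] costs at most [2 |b| d / k] in the first term and
   [2 |a| d / k] in the second; the summand 1 makes [k] positive. *)
move=> d d0; pose k := 2 * (rn a + rn b) + 1.
have k0 : 0 < k by rewrite ltr_wpDl // mulr_ge0 // addr_ge0 ?Re_norm_ge0.
have [P [NP [s [os sa]] [t [ot tb]]]] := ab _ (divr_gt0 d0 k0).
have cP := nest_subspace NP.
have lP := orth_proj_linear hip cP; have lPC := orth_projC_linear hip cP.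
have lA : linear (a \o orth_proj ip P) by apply: linear_comp =>
  //; exact: nest_alg_linear.
have lAC : linear (a \o orth_projC ip P) by apply: linear_comp =>
  //; exact: nest_alg_linear.
have bA : bounded_op (a \o orth_proj ip P).
  by apply: bounded_op_comp; [exact: nest_alg_bounded|exact: orth_proj_bounded].
have bAC : bounded_op (a \o orth_projC ip P).
  by apply: bounded_op_comp; [exact: nest_alg_bounded|exact: orth_projC_bounded].
(* The norm of the [inl e] probe bounds the coordinate of [a P z b h] along [e] for [|h| <= 1]. In
   the [inr e] probe the factor [rn b] bounds the coefficient of [P~ b h] along [e]. *)
pose rho (i : H + H) (z : nest_alg N) := match i with
  | inl e => adjoint ip ((a \o orth_proj ip P) \o z \o b) e
  | inr e => (a \o orth_projC ip P) (z ((rn b)%:C%C *: e)) end.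
exists (H + H)%type, rho, ([seq inl e | e <- s] ++ [seq inr e | e <- t]).
split=> [[e|e]|z z2].
- by apply: wot_probe_adjoint => //; [exact: nest_alg_linear|exact: nest_alg_bounded].
- exact: wot_probe_vector.
have -> : \sum_(i <- [seq inl e | e <- s] ++ [seq inr e | e <- t]) rn (rho i z) =
    \sum_(e <- s) rn (rho (inl e) z) + \sum_(e <- t) rn (rho (inr e) z).
  by rewrite big_cat !big_map.
apply: (@opnorm_le _ _ _ (mul_op a b z)) => h; rewrite Re_norm_le1 => h1.
pose x := z (b h); pose y := orth_projC ip P (b h).
have bh : rn (b h) <= rn b.
  by rewrite (le_trans (nest_alg_le _ _)) // -[leRHS]mulr1 ler_wpM2l ?Re_norm_ge0.
have zle (w : H) : rn (z w) <= 2 * rn w.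
  by rewrite (le_trans (nest_alg_le _ _)) // ler_wpM2r ?Re_norm_ge0.
have xle : rn x <= 2 * rn b by rewrite (le_trans (zle _)) // ler_wpM2l.
have -> : mul_op a b z h = (a \o orth_proj ip P) x + (a \o orth_projC ip P) (z y).
  rewrite -[LHS]/(a x) /= -(linear_D (nest_alg_linear a)); congr (a _).
  rewrite -[LHS](orth_projD ip P); congr (_ + _).
  rewrite /y {1}/orth_projC (linear_B (nest_alg_linear z)) (linear_B lPC).
  rewrite [orth_projC ip P (z (orth_proj _ _ _))](orth_projC_id hip cP) ?subr0 //.
  by apply: nest_alg_inv => //; exact: orth_proj_in.
have k1 : 0 < d / k by rewrite divr_gt0.
have dk : d / k * (2 * rn b) + d / k * (2 * rn a) + d / k = d.
  have : d / k * k = d by rewrite divfK // gt_eqF.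
  by move: (d / k) => q; rewrite /k => <-; ring.
have yb : rn y <= rn b by rewrite (le_trans (orth_projC_le hip cP _)).
have part1 : rn ((a \o orth_proj ip P) x) <=
    \sum_(e <- s) rn (rho (inl e) z) + d / k * (2 * rn b).
  rewrite -[(a \o _) x](subrK (fproj ip s ((a \o orth_proj ip P) x))).
  rewrite (le_trans (Re_normD _ _)) // addrC lerD //.
    apply: le_trans (fproj_norm_le hip _ os) _; apply: ler_sum => e _.
    rewrite (_ : ip _ e = ip h (rho (inl e) z)).
      rewrite (le_trans (ip_CauchySchwarz hip _ _)) // -[leRHS]mul1r.
      by rewrite ler_wpM2r ?Re_norm_ge0.
    rewrite -adjointE //.
    - apply: linear_comp; last exact: nest_alg_linear.
      by apply: linear_comp => //; exact: nest_alg_linear.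
    - apply: bounded_op_comp; last exact: nest_alg_bounded.
      by apply: bounded_op_comp => //; exact: nest_alg_bounded.
  (* The residual map is linear, so its bound on the unit ball scales to [x], of norm at most
     [2 * rn b]. *)
  pose F := fun x => (a \o orth_proj ip P) x - fproj ip s ((a \o orth_proj ip P) x).
  have lF : linear F.
    move=> c u v; rewrite /F lA (fproj_linear ip s) opprD addrACA -scalerBr.
    by [].
  have bF : bounded_op F.
    have [M M0 AM] := bounded_op_pos bA; exists M => u.
    by rewrite (le_trans (fprojC_le hip os _)).
  apply: le_trans (ler_opnorm x lF bF) _.
  apply: (@le_trans _ _ (d / k * rn x)); last by rewrite ler_wpM2l // ltW.
  rewrite ler_wpM2r ?Re_norm_ge0 // opnorm_le // => u; rewrite Re_norm_le1.
  exact: sa.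
have part2 : rn ((a \o orth_projC ip P) (z y)) <=
    \sum_(e <- t) rn (rho (inr e) z) + d / k * (2 * rn a).
  pose A := a \o orth_projC ip P.
  have lA' : linear A := lAC.
  have AE : A (z y) = \sum_(e <- t) ip y e *: A (z e) + A (z (y - fproj ip t y)).
    rewrite -[in LHS](subrK (fproj ip t y) y) addrC.
    rewrite (linear_D (nest_alg_linear z)) (linear_D lA'); congr (_ + _).
    rewrite /fproj (linear_sum_seq (nest_alg_linear z)) (linear_sum_seq lA').
    by apply: eq_bigr => e _; rewrite (linear_Z (nest_alg_linear z)) (linear_Z lA').
  rewrite -/A AE (le_trans (Re_normD _ _)) // lerD //.
    apply: le_trans (Re_norm_sum _ _) _; rewrite !big_seq; apply: ler_sum => e et.
    rewrite /rho (linear_Z (nest_alg_linear z)) (linear_Z lAC) Re_normZ.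
    rewrite Re_normZr ?Re_norm_ge0 // ler_wpM2r ?Re_norm_ge0 //.
    rewrite (le_trans (ip_CauchySchwarz hip _ _)) //.
    by rewrite (orthonormal_norm hip ot et) mulr1.
  have := tb _ h1; rewrite -/y => yt.
  rewrite (le_trans (nest_alg_le _ _)) // mulrA [leRHS]mulrC.
  rewrite ler_wpM2l ?Re_norm_ge0 // [leRHS]mulrC.
  by rewrite (le_trans (orth_projC_le hip cP _)) // (le_trans (zle _)) // ler_wpM2l.
apply: le_trans (Re_normD _ _) _.
by move: part1 part2 k1 dk; lra.
Qed.

End Sufficiency.

(** * Necessity *)

Section OrthonormalSequences.
Context {R : realType} {H : completeNormedModType R[i]}.
Variables (ip : {dot H for Num.conj}) (hip : inner_product_norm ip).

Lemma sqr_norm_orthonormal_sum (e : nat -> H) (c : nat -> R[i]) n :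
  (forall i j, ip (e i) (e j) = (i == j)%:R) ->
  rn (\sum_(j < n) c j *: e j) ^+ 2 = \sum_(j < n) rn (c j) ^+ 2.
Proof.
move=> oe; elim: n => [|n IH]; first by rewrite !big_ord0 Re_norm0 expr0n.
rewrite !big_ord_recr /= (pythagoras hip) ?IH; last first.
  rewrite linear_sumlz big1 // => j _ /=.
  by rewrite ipZl ipZr oe ltn_eqF // !mulr0.
congr (_ + _ ^+ 2); rewrite Re_normZ -[RHS]mulr1; congr (_ * _).
by apply: (ip1_norm hip); rewrite oe eqxx.
Qed.

(** Bessel's inequality: the sum has the same norm as [Q], the projection of [x] onto the span of
    the first [n] vectors [g j]. *)
Lemma partial_isometry_le (f g : nat -> H) n x :
  (forall i j, ip (f i) (f j) = (i == j)%:R) ->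
  (forall i j, ip (g i) (g j) = (i == j)%:R) ->
  rn (\sum_(j < n) ip x (g j) *: f j) <= rn x.
Proof.
move=> of' og; pose Q := \sum_(j < n) ip x (g j) *: g j.
have Qx : rn Q <= rn x.
  rewrite -[X in _ <= rn X](subrK Q) addrC; apply: (pythagoras_le hip).
  rewrite {1}/Q linear_sumlz big1 // => j _ /=; rewrite ipZl (ip_eq0C (x :=
    x - Q)) ?mulr0 //.
  rewrite linearBl /= /Q linear_sumlz (bigD1 j) //= ipZl og eqxx mulr1 big1
    ?addr0 ?subrr //.
  by move=> i ij; rewrite ipZl og (negPf (ij : (i : nat) != j)) mulr0.
apply: le_trans Qx; rewrite -(@ler_pXn2r _ 2) ?nnegrE ?Re_norm_ge0 //.
by rewrite !(sqr_norm_orthonormal_sum (fun j => ip x (g j))).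
Qed.

End OrthonormalSequences.

Section NonWeakCompactness.
Context {R : realType} {H : completeNormedModType R[i]}.
Variables (ip : {dot H for Num.conj}) (hip : inner_product_norm ip).
Variable N : nest H.
Implicit Types (z a b : nest_alg N).

Definition rank_one (f g : H) : H -> H := fun x => ip x g *: f.

(** The limit along [F] exists for every bounded scalar sequence and is linear in [z]. For a free
    ultrafilter, the resulting functional depends only on the tails of [u] and [v]. *)
Lemma ultra_limit_cdual (F : set_system nat) (u v : nat -> H) (K : R) :
  UltraFilter F -> (forall k, rn (u k) <= K) -> (forall k, rn (v k) <= K) ->
  exists phi : cdual (nest_alg N), forall z,
    (fun k => ip (z (u k)) (v k)) @ F --> (sval phi z : R[i]^o).
Proof.
move=> UF uK vK.
have K0 : 0 <= K by apply: le_trans (uK 0%N); exact: Re_norm_ge0.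
have bd z k : rn (ip (z (u k)) (v k)) <= K * K * rn z.
  rewrite (le_trans (ip_CauchySchwarz hip _ _)) // mulrAC.
  rewrite ler_pM ?Re_norm_ge0 // mulrC (le_trans (nest_alg_le _ _)) //.
  by rewrite ler_wpM2l ?Re_norm_ge0.
have /choice[l lF] z : exists c : R[i],
    (fun k => ip (z (u k)) (v k)) @ F --> (c : R[i]^o).
  apply: (@ultra_bounded_cvg _ _ _ _ _ (K * K * rn z)).
  by apply: filterE => k; exact: bd.
have [c x y|z|phi phiE] := @bounded_cdual _ (nest_alg N) l (K * K).
- apply: (@cvg_unique R[i]^o _ ((fun k => ip ((c *: x + y) (u k)) (v k)) @ F)).
  + exact: norm_hausdorff.
  + exact: lF.
  rewrite (_ : (fun k => _) = (fun k => c * ip (x (u k)) (v k) + ip (y (u k)) (v k))).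
    exact: cvg_lincomb (lF x) (lF y).
  by apply/funext => k; rewrite nest_algDE nest_algZE linearDl /= ipZl.
- apply/ler_addgt0Pr => e e0.
  have /(@Re_norm_cvg _ R[i]^o)/(_ _ e0) lFe := lF z.
  have [k ke] := filter_ex lFe.
  rewrite -[l z](subrK (ip (z (u k)) (v k))) (le_trans (Re_normcD _ _)) // addrC.
  by rewrite lerD ?(ltW ke) // bd.
by exists phi => z; rewrite phiE; exact: lF.
Qed.

Lemma not_weakly_compact_of_diagonal a b (f g : nat -> H) (d : R) :
  0 < d ->
  (forall i j, ip (f i) (f j) = (i == j)%:R) ->
  (forall i j, ip (g i) (g j) = (i == j)%:R) ->
  (forall n, rank_one (f n) (g n) \in nest_alg_pred N) ->
  (forall i j, i != j -> ip (a (f i)) (a (f j)) = 0) ->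
  (forall n, d <= rn (a (f n))) -> (forall n, d <= rn (adjoint ip b (g n))) ->
  ~ weakly_compact_op (mul_op a b).
Proof.
move=> d0 of' og fgN oaf af bg wc.
have lb := nest_alg_linear b; have bb := nest_alg_bounded b.
pose u k := adjoint ip b (g k); pose v k := a (f k).
pose X n : nest_alg N := \sum_(j < n.+1) NestAlg (fgN j).
have XE n x : X n x = \sum_(j < n.+1) ip x (g j) *: f j.
  rewrite /X; elim: (n.+1) => [|m IH]; first by rewrite !big_ord0.
  by rewrite [RHS]big_ord_recr -IH big_ord_recr.
have X1 n : rn (X n) <= 1.
  apply: nest_alg_norm_le => // x; rewrite mul1r XE.
  exact: (partial_isometry_le hip).
pose y n := mul_op a b (X n).
(* Orthogonality of the [a (f j)] leaves only the summand [j = k], which is present exactly when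
   [k <= n], as [X n] has [n.+1] summands. *)
have yE n k : ip (y n (u k)) (v k) =
    (if (k <= n)%N then rn (u k) ^+ 2 * rn (v k) ^+ 2 else 0)%:C%C.
  rewrite -[y n _]/(a (X n (b (u k)))) XE (linear_sum_seq (nest_alg_linear a)).
  rewrite linear_sumlz; case: ifPn => kn.
    rewrite (bigD1 (Ordinal (kn : (k < n.+1)%N))) //= big1 ?addr0 => [|j jk].
      rewrite (linear_Z (nest_alg_linear a)) ipZl (adjointE hip lb bb).
      by rewrite !(ipE hip) -rmorphM.
    by rewrite (linear_Z (nest_alg_linear a)) ipZl oaf ?mulr0.
  rewrite big1 // => j _ /=; rewrite (linear_Z (nest_alg_linear a)) ipZl oaf ?mulr0 //.
  by rewrite neq_ltn (leq_trans (ltn_ord j)) // ltnNge.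
have f1 n : rn (f n) <= 1.
  by rewrite (ip1_norm hip) // of' eqxx.
have g1 n : rn (g n) <= 1.
  by rewrite (ip1_norm hip) // og eqxx.
pose K := Num.max (rn b) (rn a).
have uK k : rn (u k) <= K.
  rewrite /K le_max; apply/orP; left;
    apply: le_trans (adjoint_le hip lb bb (Re_norm_ge0 _) (nest_alg_le b) _) _.
  by rewrite -[leRHS]mulr1 ler_wpM2l ?Re_norm_ge0.
have vK k : rn (v k) <= K.
  rewrite /K le_max; apply/orP; right; apply: le_trans (nest_alg_le a _) _.
  by rewrite -[leRHS]mulr1 ler_wpM2l ?Re_norm_ge0.
(* [F] refines the filter of cofinite tails, so eventually constant sequences converge along it. It
   serves both for the index [n] of [y] and for the index [k] defining [phi]. *)
have [F [UF oF]] := ultraFilterLemma (eventually_filter : ProperFilter \oo).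
have [phi phiF] := ultra_limit_cdual UF uK vK.
have luniq (h : nat -> R[i]) (p q : R[i]) :
    h @ F --> (p : R[i]^o) -> h @ F --> (q : R[i]^o) -> p = q.
  by apply: (@cvg_unique R[i]^o); exact: norm_hausdorff.
move: wc; rewrite /weakly_compact_op precompactE compact_ultra.
move=> /(_ (y @ F) (ultra_fmap y UF)) [|Y [_ yY]].
  apply: (@filterS _ F _ setT) => [n _|]; last exact: filterT.
  by apply: subset_closure; exists (X n) => //; rewrite /closed_unit_ball /= Re_norm_le1.
have ev (h : nat -> R[i]) (p : R[i]) m : (forall n, (m <= n)%N -> h n = p) ->
    h @ F --> (p : R[i]^o).
  move=> hp; apply/(@Re_norm_cvg _ R[i]^o) => e e0; apply: oF; exists m => // n mn.
  by rewrite /mkset hp // subrr normr0.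
have YE k : ip (Y (u k)) (v k) = (rn (u k) ^+ 2 * rn (v k) ^+ 2)%:C%C.
  have [psi psiE] : exists psi :
    cdual (nest_alg N), forall z, sval psi z = ip (z (u k)) (v k).
    apply: (@bounded_cdual _ _ _ (rn (u k) * rn (v k))) => [c x z|z].
      by rewrite nest_algDE nest_algZE linearDl /= ipZl.
    rewrite (le_trans (ip_CauchySchwarz hip _ _)) // [leRHS]mulrAC.
    by rewrite ler_wpM2r ?Re_norm_ge0 // mulrC nest_alg_le.
  have /weak_cvgP/(_ psi) yp := yY; rewrite -psiE.
  apply: (luniq _ _ _ yp); apply: (ev _ _ k) => n kn.
  by rewrite psiE yE kn.
have Y0 : sval phi Y = 0.
  have /weak_cvgP/(_ phi) yp := yY.
  apply: (luniq _ _ _ yp); apply: (ev _ _ 0%N) => n _ /=.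
  apply: (luniq _ _ _ (phiF (y n))); apply: (ev _ _ n.+1) => k nk.
  by rewrite yE leqNgt nk.
have d4 : 0 < d ^+ 2 * d ^+ 2 by rewrite mulr_gt0 // exprn_gt0.
have /(@Re_norm_cvg _ R[i]^o)/(_ _ d4) := phiF Y; rewrite Y0 => /filter_ex[k].
rewrite /mkset YE sub0r normrN Re_normc_real ?mulr_ge0 ?Re_norm_ge0 //.
rewrite ltNge => /negP; apply.
have sqr_le (r : R) : d <= r -> d ^+ 2 <= r ^+ 2.
  by move=> dr; rewrite lerXn2r // nnegrE ?(le_trans _ dr) // ltW.
by apply: ler_pM; rewrite ?sqr_ge0 // sqr_le // ?bg ?af.
Qed.

Lemma not_weakly_compact a b (d : R) : 0 < d ->
  (forall s t : seq H, exists f g, [/\ rn f = 1 /\ rn g = 1,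
     forall x, x \in s -> ip f x = 0, forall x, x \in t -> ip g x = 0,
     rank_one f g \in nest_alg_pred N &
     d <= rn (a f) /\ d <= rn (adjoint ip b g)]) ->
  ~ weakly_compact_op (mul_op a b).
Proof.
move=> d0 ex.
(* Orthogonality of [f] to [adjoint ip a (a f')] means that [a f] is orthogonal to [a f']; the first
   half of the list makes [f] orthogonal to the earlier [f']. *)
pose S (l : seq (H * H)) :=
  [seq q.1 | q <- l] ++ [seq adjoint ip a (a q.1) | q <- l].
have /choice[step stepP] (l : seq (H * H)) : exists p : H * H,
    [/\ rn p.1 = 1 /\ rn p.2 = 1,
     forall x, x \in S l -> ip p.1 x = 0,
     forall x, x \in [seq q.2 | q <- l] -> ip p.2 x = 0,
     rank_one p.1 p.2 \in nest_alg_pred N &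
     d <= rn (a p.1) /\ d <= rn (adjoint ip b p.2)].
  by have [f [g fg]] := ex (S l) [seq q.2 | q <- l]; exists (f, g).
pose L := fix L n := if n is m.+1 then step (L m) :: L m else [::].
pose p n := step (L n).
have pL i n : (i < n)%N -> p i \in L n.
  elim: n => // n IH; rewrite ltnS leq_eqVlt inE => /predU1P[->|/IH ->].
    by rewrite eqxx.
  by rewrite orbT.
have pp n : _ := stepP (L n); rewrite -/(p _) in pp.
have orth (h : nat -> H) : (forall n, rn (h n) = 1) ->
    (forall i n, (i < n)%N -> ip (h n) (h i) = 0) ->
    forall i j, ip (h i) (h j) = (i == j)%:R.
  move=> h1 hh i j; case: ltngtP => [ij|ij|->].
  - by apply: ip_eq0C; exact: hh.
  - exact: hh.
  - by rewrite (ipE hip) h1 expr1n.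
apply: (@not_weakly_compact_of_diagonal a b (fun n => (p n).1) (fun n => (p n).2) d d0).
- apply: orth => [n|i n ni]; first by have [[]] := pp n.
  have [_ fo _ _ _] := pp n; apply: fo; rewrite mem_cat; apply/orP; left.
  by apply/mapP; exists (p i) => //; exact: pL.
- apply: orth => [n|i n ni]; first by have [[]] := pp n.
  have [_ _ go _ _] := pp n; apply: go.
  by apply/mapP; exists (p i) => //; exact: pL.
- by move=> n; have [] := pp n.
- have af i n : (i < n)%N -> ip (a (p n).1) (a (p i).1) = 0.
    move=> ni; have [_ fo _ _ _] := pp n.
    rewrite (adjointE hip (nest_alg_linear a) (nest_alg_bounded a)).
    apply: fo; rewrite mem_cat; apply/orP; right.
    by apply/mapP; exists (p i) => //; exact: pL.
  move=> i j; rewrite neq_ltn => /orP[ij|]; last exact: af.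
  by apply: ip_eq0C; exact: af.
- by move=> n; have [_ _ _ _ []] := pp n.
- by move=> n; have [_ _ _ _ []] := pp n.
Qed.

End NonWeakCompactness.

(** * Closures, orthocomplements and chains of subspaces *)

Section Closures.
Context {R : realType} {V : normedModType R[i]}.

Lemma closureP (D : set V) x :
  closure D x <-> forall e : R, 0 < e -> exists2 y, D y & rn (x - y) < e.
Proof.
split=> [Dx e e0|Dx A].
  have [|y [Dy]] := Dx (ball x e%:C%C); first by apply: nbhsx_ballx; rewrite ltcR.
  by rewrite -ball_normE /= Re_norm_lt => xy; exists y.
move=> /nbhs_ballP[e /= e0 eA].
have [er r0] : e = (complex.Re e)%:C%C /\ 0 < complex.Re e.
  by move: e0; case: (e) => a b; rewrite ltcE /= => /andP[/eqP-> ->].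
have [y Dy xy] := Dx _ r0; exists y; split=> //; apply: eA.
by rewrite er -ball_normE /= Re_norm_lt.
Qed.

Lemma closure_closed_subspace (D : set V) : subspace_set D -> closed_subspace (closure D).
Proof.
move=> sD; split; first exact: closed_closure.
split=> [|c u v /closureP Du /closureP Dv]; first exact: (subset_closure sD.1).
apply/closureP => e e0.
have c1 : 0 < rn c + 1 by rewrite ltr_wpDl ?Re_normc_ge0.
have [|u' Du' uu'] := Du (e / 2 / (rn c + 1)); first by rewrite !divr_gt0.
have [|v' Dv' vv'] := Dv (e / 2); first by rewrite divr_gt0.
exists (c *: u' + v'); first exact: sD.2.
rewrite opprD addrACA -scalerBr (le_lt_trans (Re_normD _ _)) // Re_normZ.
move: uu'; rewrite ltr_pdivlMr // => uu'.
have : rn c * rn (u - u') <= rn (u - u') * (rn c + 1).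
  by rewrite mulrC ler_wpM2l ?Re_norm_ge0 // lerDl.
by move: vv' uu'; move: (rn c * _) (_ * (rn c + 1)) => p q; lra.
Qed.

Lemma bigcup_chain_subspace (W : set (set V)) : W !=set0 ->
  (forall P, W P -> subspace_set P) ->
  (forall P Q, W P -> W Q -> P `<=` Q \/ Q `<=` P) ->
  subspace_set (\bigcup_(P in W) P).
Proof.
move=> [P0 WP0] sW chW; split; first by exists P0 => //; exact: (sW _ WP0).1.
move=> c u v [P WP Pu] [Q WQ Qv]; have [PQ|QP] := chW _ _ WP WQ.
- by exists Q => //; apply: (sW _ WQ).2 => //; exact: PQ.
- by exists P => //; apply: (sW _ WP).2 => //; exact: QP.
Qed.

End Closures.

Section Orthocomplement.
Context {R : realType} {H : completeNormedModType R[i]}.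
Variables (ip : {dot H for Num.conj}) (hip : inner_product_norm ip).
Implicit Types P Q : set H.

Definition orthocomplement P : set H := [set x | forall z, P z -> ip x z = 0].

Lemma orthocomplement_proj P x :
  closed_subspace P -> orthocomplement P (orth_projC ip P x).
Proof. by move=> cP z Pz; exact: orth_projC_ip. Qed.

Lemma orthocomplement_closed_subspace P : closed_subspace P ->
  closed_subspace (orthocomplement P).
Proof.
move=> cP; split; last first.
  split=> [z _|c u v Pu Pv z Pz]; first by rewrite linear0l.
  by rewrite linearDl /= ipZl Pu // Pv // mulr0 addr0.
move=> x /closureP Px; rewrite -[x](orth_projD ip P).
suff -> : orth_proj ip P x = 0 by rewrite add0r; exact: orthocomplement_proj.
apply/eqP; rewrite -Re_norm_eq0 eq_le Re_norm_ge0 andbT.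
apply/ler_addgt0Pr => e e0; have [y Py xy] := Px _ e0.
rewrite add0r -[x](subrK y) (linear_D (orth_proj_linear hip cP)).
by rewrite (orth_proj_perp hip cP Py) addr0 (le_trans (orth_proj_le hip cP _)) // ltW.
Qed.

Lemma orthocomplementK P x : closed_subspace P ->
  (forall z, orthocomplement P z -> ip x z = 0) -> P x.
Proof.
move=> cP xP; suff : orth_projC ip P x = 0.
  by move/eqP; rewrite subr_eq0 => /eqP ->; exact: orth_proj_in.
apply/eqP; rewrite -(dnorm_eq0 ip) {1}/orth_projC linearBl /=.
rewrite xP; last exact: orthocomplement_proj.
rewrite (ip_eq0C (orth_projC_ip hip cP _ (orth_proj_in hip cP x))) subrr //.
Qed.

Lemma orth_proj_orthocomplement P : closed_subspace P ->
  orth_proj ip (orthocomplement P) = orth_projC ip P.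
Proof.
move=> cP; apply/funext => x; apply: orth_proj_uniq => //.
- exact: orthocomplement_closed_subspace.
- exact: orthocomplement_proj.
- move=> z Pz; rewrite opprB addrC subrK; apply: ip_eq0C; apply: Pz.
  exact: orth_proj_in.
Qed.

Lemma orth_proj_sub P Q x : closed_subspace P -> closed_subspace Q -> P `<=` Q ->
  orth_proj ip P (orth_proj ip Q x) = orth_proj ip P x.
Proof.
move=> cP cQ PQ; apply: orth_proj_uniq => // [|z Pz]; first exact: orth_proj_in.
by rewrite linearBl /= (orth_proj_ipl hip cQ _ (PQ _ Pz)) -linearBl /=
  (orth_projC_ip hip cP).
Qed.

(* x lies in the closure of the union of the orthocomplements of the P in W *)
Lemma orth_proj_chain_small (W : set (set H)) (x : H) (e : R) : W !=set0 ->
  (forall P, W P -> closed_subspace P) ->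
  (forall P Q, W P -> W Q -> P `<=` Q \/ Q `<=` P) ->
  (forall z, (forall P, W P -> P z) -> ip x z = 0) -> 0 < e ->
  exists2 P, W P & rn (orth_proj ip P x) < e.
Proof.
move=> [P0 WP0] cW chW xW e0.
pose D := \bigcup_(P in [set orthocomplement P | P in W]) P.
have sD : subspace_set D.
  apply: bigcup_chain_subspace.
  - by exists (orthocomplement P0), P0.
  - by move=> _ [P WP <-]; have [] := orthocomplement_closed_subspace (cW _ WP).
  - move=> _ _ [P WP <-] [Q WQ <-]; have [PQ|QP] := chW _ _ WP WQ; [right|left].
    + by move=> z Qz y Py; apply: Qz; exact: PQ.
    + by move=> z Pz y Qy; apply: Pz; exact: QP.
have cD := closure_closed_subspace sD.
(* [w] is orthogonal to all the orthocomplements, so it lies in every [P] of [W]; by hypothesis [x]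
   is then orthogonal to [w], whence [w = 0]. *)
pose w := orth_projC ip (closure D) x.
have w0 : w = 0.
  apply/eqP; rewrite -(dnorm_eq0 ip) {1}/w /orth_projC linearBl /= xW.
    by rewrite (ip_eq0C (orth_projC_ip hip cD _ (orth_proj_in hip cD x))) subrr.
  move=> P WP; apply: (orthocomplementK (cW _ WP)) => z Pz.
  apply: (orth_projC_ip hip cD); apply: subset_closure.
  by exists (orthocomplement P) => //; exists P.
have /closureP Dx : closure D x.
  by move/eqP: w0; rewrite subr_eq0 => /eqP ->; exact: orth_proj_in.
have [y [_ [P WP <-] Py] xy] := Dx _ e0; exists P => //.
rewrite -[x](subrK y) (linear_D (orth_proj_linear hip (cW _ WP))).
rewrite (orth_proj_perp hip (cW _ WP) Py) addr0.
exact: le_lt_trans (orth_proj_le hip (cW _ WP) _) xy.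
Qed.

End Orthocomplement.

(** * Stability of finite rank approximation *)

Section FiniteRankCalculus.
Context {R : realType} {H : completeNormedModType R[i]}.
Variables (ip : {dot H for Num.conj}) (hip : inner_product_norm ip).
Implicit Types (T C : H -> H) (P : set H) (d : R).

Lemma fproj_mul C (s t : seq H) x : linear C ->
  (forall y, y \in [seq C e | e <- s] -> fproj ip t y = y) ->
  fproj ip t (C (fproj ip s x)) = C (fproj ip s x).
Proof.
move=> lC tC; rewrite {2 3}/fproj (linear_sum_seq lC) (linear_sum_seq
  (fproj_linear ip t)).
rewrite !big_seq; apply: eq_bigr => e es.
by rewrite (linear_Z lC) (linear_Z (fproj_linear ip t)) tC // map_f.
Qed.

Lemma fin_within_mull C T d : linear C -> (forall x, rn (C x) <= rn x) ->
  fin_within ip d T -> fin_within ip d (C \o T).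
Proof.
move=> lC C1 [s [os sT]].
apply: (@fin_withinP _ _ _ hip d _ [seq C e | e <- s] (fun x => C (fproj ip s (T x)))).
  by move=> t _ tC x _; exact: fproj_mul.
by move=> x x1; rewrite -(linear_B lC) (le_trans (C1 _)) // sT.
Qed.

Lemma fin_within_mulr C T d : (forall x, rn (C x) <= rn x) ->
  fin_within ip d T -> fin_within ip d (T \o C).
Proof. by move=> C1 [s [os sT]]; exists s; split=> // x x1; apply: sT;
  exact: le_trans (C1 x) x1. Qed.

Lemma fin_within_add T C d e : fin_within ip d T ->
  (forall x, rn x <= 1 -> rn (C x) <= e) ->
  fin_within ip (d + e) (fun x => T x + C x).
Proof.
move=> [s [os sT]] Ce; exists s; split=> // x x1.
rewrite (linear_D (fproj_linear ip s)) opprD addrACA (le_trans (Re_normD _ _)) //.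
by rewrite lerD ?sT // (le_trans (fprojC_le hip os _)) // Ce.
Qed.

(** The adjoint of [fproj ip s \o T] is [adjoint ip T \o fproj ip s], again of finite rank, and
    taking adjoints preserves the distance. *)
Lemma adjoint_fin_within T d : linear T -> bounded_op T -> 0 <= d ->
  fin_within ip d T -> fin_within ip d (adjoint ip T).
Proof.
move=> lT bT d0 [s [os sT]]; have lA := adjoint_linear hip lT bT.
apply: (@fin_withinP _ _ _ hip d _ [seq adjoint ip T e | e <- s]
  (fun x => adjoint ip T (fproj ip s x))).
  by move=> t _ tC x _; exact: fproj_mul.
move=> x x1; rewrite -(linear_B lA); apply: (rn_le_ip hip) => // y y1.
rewrite Re_norm_ipC -(adjointE hip lT bT) linearBr /= -(fproj_adj ip) -linearBl /=.
rewrite (le_trans (ip_CauchySchwarz hip _ _)) // -[leRHS]mulr1.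
by rewrite ler_pM ?Re_norm_ge0 // sT.
Qed.

End FiniteRankCalculus.

(** * Vectors on which a non-compact operator is bounded below *)

Section LargeVectors.
Context {R : realType} {H : completeNormedModType R[i]}.
Variables (ip : {dot H for Num.conj}) (hip : inner_product_norm ip).
Variable T : H -> H.
Hypotheses (lT : linear T) (bT : bounded_op T).
Implicit Types (M D P S : set H) (W : set (set H)).

Lemma unit_vector_le D (s : seq H) (d : R) : subspace_set D ->
  (forall g, D g -> rn g = 1 -> (forall x, x \in s -> ip g x = 0) -> rn (T g) <= d) ->
  forall g, D g -> (forall x, x \in s -> ip g x = 0) -> rn (T g) <= d * rn g.
Proof.
move=> sD TD g Dg gs; have [->|g0] := eqVneq g 0.
  by rewrite (linear_0 lT) Re_norm0 mulr0.
have g1 : 0 < rn g by rewrite lt_def Re_norm_eq0 g0 Re_norm_ge0.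
have := TD ((rn g)^-1%:C%C *: g) (subspaceZ sD _ Dg).
rewrite (linear_Z lT) !Re_normZr ?invr_ge0 ?Re_norm_ge0 // mulVf ?gt_eqF //.
rewrite ler_pdivrMl // mulrC; apply=> // x xs.
by rewrite ipZl gs // mulr0.
Qed.

(** The constraints are imposed one at a time. If [h] is not orthogonal to [D], an approximant [w]
    is corrected by a multiple of a fixed [w1] with [ip w1 h = 1]; the coefficient is small because
    [m] is orthogonal to [h]. *)
Lemma dense_finite_codim D (s : seq H) (m : H) : subspace_set D -> closure D m ->
  (forall x, x \in s -> ip m x = 0) ->
  closure (D `&` [set g | forall x, x \in s -> ip g x = 0]) m.
Proof.
elim: s D => [|h s IH] D sD Dm ms.
  by apply: closureS Dm => g Dg; split.
pose D' := D `&` [set g | ip g h = 0].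
have sD' : subspace_set D'.
  split; first by split; [exact: sD.1|rewrite /mkset linear0l].
  move=> c u v [Du uh] [Dv vh]; split; first exact: sD.2.
  by rewrite /mkset linearDl /= ipZl uh vh mulr0 addr0.
have mh : ip m h = 0 by apply: ms; rewrite inE eqxx.
have D'm : closure D' m.
  have [Dh|] := pselect (forall w, D w -> ip w h = 0).
    by apply: closureS Dm => w Dw; split=> //; exact: Dh.
  move=> /existsNP[w0 /not_implyP[Dw0 /eqP w0h]].
  pose w1 := (ip w0 h)^-1 *: w0.
  have Dw1 : D w1 by exact: subspaceZ.
  have w1h : ip w1 h = 1 by rewrite ipZl mulVf.
  apply/closureP => e e0; move/closureP: Dm => Dm.
  have k0 : 0 < 1 + rn h * rn w1 by rewrite ltr_pwDl // mulr_ge0 ?Re_norm_ge0.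
  have [w Dw mw] := Dm _ (divr_gt0 e0 k0).
  exists (w - ip w h *: w1).
    split; first by apply: subspaceB => //; exact: subspaceZ.
    by rewrite /mkset linearBl /= ipZl w1h mulr1 subrr.
  rewrite opprB addrCA addrC (le_lt_trans (Re_normD _ _)) // Re_normZ.
  have -> : ip w h = - ip (m - w) h by rewrite linearBl /= mh sub0r opprK.
  rewrite normrN; have := ip_CauchySchwarz hip (m - w) h.
  move=> /(ler_wpM2r (Re_norm_ge0 w1)).
  move: mw; rewrite ltr_pdivlMr // mulrDr mulr1 mulrA.
  by move: (rn (ip _ _) * _) (_ * rn h * _) => p q; lra.
have := IH _ sD' D'm; case/(_ _)/wrap => [x xs|]; first by apply: ms; rewrite inE xs orbT.
apply: closureS => g [[Dg gh] gs]; split=> // x; rewrite inE => /predU1P[->//|].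
exact: gs.
Qed.

(** Otherwise, for some [d] and [s], [T] is bounded by [d] on the vectors of the chain orthogonal to
    [s]. By density this extends to [M], so [T] on [M] is within [d] of its restriction to a
    finite-dimensional subspace. *)
Lemma large_of_not_fin_within M W : closed_subspace M -> W !=set0 ->
  (forall P, W P -> subspace_set P) ->
  (forall P Q, W P -> W Q -> P `<=` Q \/ Q `<=` P) ->
  M `<=` closure (\bigcup_(P in W) P) ->
  ~ (forall d : R, 0 < d -> fin_within ip d (T \o orth_proj ip M)) ->
  exists2 d : R, 0 < d & forall s : seq H, exists P g,
    [/\ W P, P g, rn g = 1, forall x, x \in s -> ip g x = 0 & d <= rn (T g)].
Proof.
move=> cM W0 sW chW MW nfin; apply: contrapT => noex; apply: nfin => d d0.
have [s sd] : exists s : seq H, forall P g, W P -> P g -> rn g = 1 ->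
    (forall x, x \in s -> ip g x = 0) -> rn (T g) <= d.
  apply: contrapT => /forallNP nos; apply: noex; exists d => // s.
  have := nos s; move=> /existsNP[P /existsNP[g]].
  move=> /not_implyP[WP /not_implyP[Pg /not_implyP[g1 /not_implyP[gs /negP Tg]]]].
  by exists P, g; split=> //; rewrite ltW // ltNge.
pose D := \bigcup_(P in W) P.
have sD : subspace_set D by exact: bigcup_chain_subspace.
have TD := @unit_vector_le D s d sD (fun g '(ex_intro2 P WP Pg) => sd P g WP Pg).
have [K K0 TK] := bounded_op_pos bT.
have TM m : M m -> (forall x, x \in s -> ip m x = 0) -> rn (T m) <= d * rn m.
  move=> Mm ms; have /closureP mD := dense_finite_codim sD (MW _ Mm) ms.
  apply/ler_addgt0Pr => e e0; have k0 : 0 < d + K by rewrite addr_gt0.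
  have [w [Dw ws] mw] := mD _ (divr_gt0 e0 k0).
  rewrite -{1}[m](subrK w) (linear_D lT) (le_trans (Re_normD _ _)) //.
  have := TD _ Dw ws; have := TK (m - w).
  have : rn w <= rn m + rn (m - w).
    by have := Re_normB m (m - w); rewrite opprB addrC subrK.
  move=> /(ler_wpM2l (ltW d0)); rewrite mulrDr.
  by move: mw; rewrite ltr_pdivlMr // mulrDr ![_ * d]mulrC ![_ * K]mulrC; lra.
(* [t] spans the projections of [s] to [M]: vectors of [M] orthogonal to [t] are orthogonal to
   [s]. *)
have [|t [ot Mt ts]] := @GramSchmidt _ _ ip hip M [seq orth_proj ip M x | x <- s] cM.2.
  by move=> _ /mapP[x _ ->]; exact: orth_proj_in.
apply: (@fin_withinP _ _ _ hip d _ [seq T e | e <- t] (fun x =>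
  T (fproj ip t (orth_proj ip M x)))).
  by move=> t' _ tC x _; exact: fproj_mul.
move=> x x1; rewrite -(linear_B lT).
set y := orth_proj ip M x; have My : M y by exact: orth_proj_in.
have Mm : M (y - fproj ip t y).
  by apply: (subspaceB cM.2) => //; apply: fproj_in => //; exact: cM.2.
apply: le_trans (TM _ Mm _) _.
  move=> z zs; rewrite -[z](orth_projD ip M) linearDr /=.
  rewrite [ip _ (orth_projC _ _ _)]ip_eq0C ?addr0; last exact: orth_projC_ip.
  rewrite -(ts (orth_proj ip M z)); last by apply/mapP; exists z.
  exact: fprojC_perp.
rewrite -[leRHS]mulr1 ler_wpM2l ?(ltW d0) // (le_trans (fprojC_le hip ot _)) //.
by rewrite (le_trans (orth_proj_le hip cM _)).
Qed.

(** The norm of the projection of a vector grows with the subspace, so the smallest of finitely many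
    members of the chain works for all of [s]. *)
Lemma chain_common_small W P0 (s : seq H) (e : R) : W P0 ->
  (forall P, W P -> closed_subspace P) ->
  (forall P Q, W P -> W Q -> P `<=` Q \/ Q `<=` P) ->
  (forall x, x \in s -> exists2 P, W P & rn (orth_proj ip P x) < e) ->
  exists P, [/\ W P, P `<=` P0 & forall x, x \in s -> rn (orth_proj ip P x) < e].
Proof.
move=> WP0 cW chW; have mono P Q x : W P -> W Q -> P `<=` Q ->
    rn (orth_proj ip Q x) < e -> rn (orth_proj ip P x) < e.
  move=> WP WQ PQ; apply: le_lt_trans.
  rewrite -(orth_proj_sub hip x (cW _ WP) (cW _ WQ) PQ).
  exact: (orth_proj_le hip (cW _ WP)).
elim: s => [|x s IH] sP; first by exists P0; split.
have [|P [WP PP0 Ps]] := IH; first by move=> y ys; apply: sP; rewrite inE ys orbT.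
have [|Q WQ Qx] := sP x; first by rewrite inE eqxx.
have [PQ|QP] := chW _ _ WP WQ.
- exists P; split=> // y; rewrite inE => /predU1P[->|/Ps//]; exact: (mono P Q).
- exists Q; split=> // [|y]; first exact: subset_trans PP0.
  by rewrite inE => /predU1P[->//|/Ps]; exact: (mono Q P).
Qed.

(** Otherwise [T] is bounded by [e / 2] on the vectors of [P0] orthogonal to [s]. A finite [t]
    accounts for [s] inside [P0] minus [S], and a small enough [P] in [W] nearly annihilates [t].
    Then [f = (P - S) x] is nearly orthogonal to [t], and [T f] is too small. *)
Lemma large_in_chain W S (e : R) : closed_subspace S -> 0 < e ->
  (forall P, W P -> closed_subspace P /\ S `<=` P) ->
  (forall P Q, W P -> W Q -> P `<=` Q \/ Q `<=` P) ->
  (forall x (d : R), (forall z, S z -> ip x z = 0) -> 0 < d ->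
     exists2 P, W P & rn (orth_proj ip P x) < d) ->
  (forall P, W P -> exists2 x, rn x <= 1 &
     e < rn (T (orth_proj ip P x - orth_proj ip S x))) ->
  forall P0, W P0 -> forall s : seq H, exists f,
    [/\ P0 f, rn f = 1, forall x, x \in s -> ip f x = 0 & e / 2 <= rn (T f)].
Proof.
move=> cS e0 cW chW smallW TW P0 WP0 s; apply: contrapT => noex.
have [cP0 SP0] := cW _ WP0.
have TP0 : forall f, P0 f -> (forall x, x \in s -> ip f x =
  0) -> rn (T f) <= e / 2 * rn f.
  apply: unit_vector_le; first exact: cP0.2.
  move=> g Pg g1 gs; rewrite leNgt; apply/negP => Tg; apply: noex.
  by exists g; split=> //; exact: ltW.
have [K K0 TK] := bounded_op_pos bT.
pose M := P0 `&` orthocomplement ip S.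
have sM : subspace_set M.
  have [_ [c1 c2]] := cP0; have [_ [d1 d2]] := orthocomplement_closed_subspace hip cS.
  by split=> // c u v [Pu Su] [Pv Sv]; split; [exact: c2|exact: d2].
have [|t [ot Mt ts]] := @GramSchmidt _ _ ip hip M [seq orth_projC ip S
  (orth_proj ip P0 x) | x <- s] sM.
  move=> _ /mapP[x _ ->]; split; last exact: orthocomplement_proj.
  apply: (subspaceB cP0.2); first exact: orth_proj_in.
  by apply: SP0; exact: orth_proj_in.
(* Chosen so that the part of [f] in the span of [t] contributes at most [e / 4]; the total is at
   most [e / 2 + e / 4 < e]. *)
pose k := e / 4 / (K * ((size t)%:R + 1)).
have n0 : 0 < (size t)%:R + 1 :> R by rewrite ltr_wpDl.
have k0 : 0 < k by rewrite !divr_gt0 // mulr_gt0.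
have [|||P [WP PP0 Pt]] := @chain_common_small W P0 t k WP0.
- by move=> P /cW[].
- exact: chW.
- by move=> x xt; apply: smallW => //; have [] := Mt _ xt.
have [cP SP] := cW _ WP.
have [x x1] := TW _ WP; apply/negP; rewrite -leNgt.
set f := orth_proj ip P x - orth_proj ip S x.
have fE : f = orth_projC ip S (orth_proj ip P x).
  by rewrite /f -(orth_proj_sub hip x cS cP SP).
have f1 : rn f <= 1.
  rewrite fE (le_trans (orth_projC_le hip cS _)) //.
  by rewrite (le_trans (orth_proj_le hip cP _)).
have Pf : P f.
  apply: (subspaceB cP.2); first exact: orth_proj_in.
  by apply: SP; exact: orth_proj_in.
have Sf z : S z -> ip f z = 0 by move=> Sz; rewrite fE; exact: orth_projC_ip.
have Mf : M f by split=> //; exact: PP0.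
have Qf : rn (fproj ip t f) <= (size t)%:R * k.
  apply: le_trans (fproj_norm_le hip f ot) _.
  rewrite -sum1_size natr_sum mulr_suml !big_seq; apply: ler_sum => y yt.
  rewrite mul1r -(orth_proj_id hip cP Pf) (orth_proj_adj hip cP).
  rewrite (le_trans (ip_CauchySchwarz hip _ _)) // -[leRHS]mul1r.
  by rewrite ler_pM ?Re_norm_ge0 // ltW // Pt.
have Mm : M (f - fproj ip t f) by apply: subspaceB => //; exact: fproj_in.
have Tm : rn (T (f - fproj ip t f)) <= e / 2.
  apply: le_trans (TP0 _ Mm.1 _) _.
    (* This vector lies in [P0] and is orthogonal to [S], so only the component [(P0 - S) z], which
       is in the span of [t], matters. *)
    move=> z zs; have -> : ip (f - fproj ip t f) z =
      ip (f - fproj ip t f) (orth_projC ip S (orth_proj ip P0 z)).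
      rewrite [RHS]linearBr /= -[in RHS](orth_proj_adj hip cP0) (orth_proj_id
        hip cP0 Mm.1).
      have Sm y : S y -> ip (f - fproj ip t f) y = 0 by exact: Mm.2.
      by rewrite (Sm (orth_proj ip S _)) ?subr0 //; exact: orth_proj_in.
    rewrite -(ts (orth_projC ip S (orth_proj ip P0 z))); last by apply/mapP; exists z.
    exact: fprojC_perp.
  rewrite -[leRHS]mulr1 ler_wpM2l ?divr_ge0 ?(ltW e0) //.
  by rewrite (le_trans (fprojC_le hip ot _)).
rewrite -[f](subrK (fproj ip t f)) (linear_D lT) (le_trans (Re_normD _ _)) //.
have := TK (fproj ip t f); have := ler_wpM2l (ltW K0) Qf.
have : K * ((size t)%:R * k) <= e / 4.
  rewrite /k mulrA mulrCA ler_piMr ?divr_ge0 ?(ltW e0) //.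
  by rewrite ler_pdivrMr ?mulr_gt0 // mul1r ler_wpM2l ?(ltW K0) // lerDl.
by lra.
Qed.

End LargeVectors.

(** * Compressions to the nest and obstructions to weak compactness *)

Section NestCompressions.
Context {R : realType} {H : completeNormedModType R[i]}.
Variables (ip : {dot H for Num.conj}) (hip : inner_product_norm ip).
Variable N : nest H.
Implicit Types (a b : nest_alg N) (P Q S : set H).

(** Invariance of [P] gives [P a P = a P] and [P~ b P~ = P~ b], so this and [right_compact] amount
    to compactness of the two compressions, by [left_compactP] and [right_compactP]. *)
Definition left_compact a P :=
  forall d : R, 0 < d -> fin_within ip d (a \o orth_proj ip P).

Definition right_compact b P :=
  forall d : R, 0 < d -> fin_within ip d (orth_projC ip P \o b).

Lemma compact_op_fin_withinP (T : H -> H) : linear T -> bounded_op T ->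
  compact_op T <-> forall d : R, 0 < d -> fin_within ip d T.
Proof.
move=> lT bT; split=> [cT d d0|]; first exact: compact_op_fin_within.
exact: fin_within_compact_op.
Qed.

Lemma left_compactP a P : N P ->
  compact_op (orth_proj ip P \o a \o orth_proj ip P) <-> left_compact a P.
Proof.
move=> NP; have cP := nest_subspace NP.
have -> : orth_proj ip P \o a \o orth_proj ip P = a \o orth_proj ip P.
  apply/funext => x /=; apply: (orth_proj_id hip cP); apply: nest_alg_inv => //.
  exact: orth_proj_in.
apply: compact_op_fin_withinP.
  by apply: linear_comp; [exact: nest_alg_linear|exact: orth_proj_linear].
by apply: bounded_op_comp; [exact: nest_alg_bounded|exact: orth_proj_bounded].
Qed.

Lemma right_compactP b P : N P ->
  compact_op (orth_projC ip P \o b \o orth_projC ip P) <-> right_compact b P.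
Proof.
move=> NP; have cP := nest_subspace NP.
have -> : orth_projC ip P \o b \o orth_projC ip P = orth_projC ip P \o b.
  apply/funext => x /=; rewrite {2}/orth_projC (linear_B (nest_alg_linear b)).
  rewrite (linear_B (orth_projC_linear hip cP)) (orth_projC_id hip cP (x :=
    b (orth_proj _ _ _))) ?subr0 //.
  by apply: nest_alg_inv => //; exact: orth_proj_in.
apply: compact_op_fin_withinP.
  by apply: linear_comp; [exact: orth_projC_linear|exact: nest_alg_linear].
by apply: bounded_op_comp; [exact: orth_projC_bounded|exact: nest_alg_bounded].
Qed.

Lemma left_compact_sub a P Q :
  N P -> N Q -> P `<=` Q -> left_compact a Q -> left_compact a P.
Proof.
move=> NP NQ PQ aQ d d0; have cP := nest_subspace NP; have cQ := nest_subspace NQ.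
have -> : a \o orth_proj ip P = (a \o orth_proj ip Q) \o orth_proj ip P.
  by apply/funext => x /=; rewrite (orth_proj_id hip cQ) //; apply: PQ;
    exact: orth_proj_in.
by apply: fin_within_mulr; [exact: orth_proj_le|exact: aQ].
Qed.

Lemma right_compact_sub b P Q :
  N P -> N Q -> P `<=` Q -> right_compact b P -> right_compact b Q.
Proof.
move=> NP NQ PQ bP d d0; have cP := nest_subspace NP; have cQ := nest_subspace NQ.
have -> : orth_projC ip Q \o b = orth_projC ip Q \o (orth_projC ip P \o b).
  apply/funext => x /=; rewrite [in RHS]/orth_projC.
  have -> : orth_proj ip Q (b x - orth_proj ip P (b x)) =
    orth_proj ip Q (b x) - orth_proj ip P (b x).
    rewrite (linear_B (orth_proj_linear hip cQ)); congr (_ - _).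
    by apply: (orth_proj_id hip cQ); apply: PQ; exact: orth_proj_in.
  by rewrite opprB addrA subrK.
by apply: fin_within_mull => //;
  [exact: orth_projC_linear|exact: orth_projC_le|exact: bP].
Qed.

(** A member inside [P] is annihilated because [g] is orthogonal to [P]; a member containing [Q]
    contains the range. *)
Lemma rank_one_nest_alg P Q f g : N P -> N Q ->
  (forall M, N M -> M `<=` P \/ Q `<=` M) -> Q f -> orthocomplement ip P g ->
  rank_one ip f g \in nest_alg_pred N.
Proof.
move=> NP NQ PQ Qf Pg; apply/mem_set; split.
- by move=> c x y; rewrite /rank_one linearDl /= ipZl scalerDl scalerA.
- exists (rn f * rn g) => x; rewrite /rank_one Re_normZ mulrC -mulrA.
  by rewrite ler_wpM2l ?Re_norm_ge0 // mulrC ip_CauchySchwarz.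
- move=> M NM _ [x Mx <-]; have [_ sM] := nest_subspace NM; rewrite /rank_one.
  have [MP|QM] := PQ _ NM; last by apply: subspaceZ => //; exact: QM.
  by rewrite (ip_eq0C (Pg _ (MP _ Mx))) scale0r; exact: sM.1.
Qed.

(** [P~ b] is the adjoint of [b* P~]. This puts non-compactness of [P~ b] in the form required by
    [large_of_not_fin_within]. *)
Lemma adjoint_not_fin_within b P : N P -> ~ right_compact b P ->
  ~ (forall d : R, 0 < d ->
     fin_within ip d (adjoint ip b \o orth_proj ip (orthocomplement ip P))).
Proof.
move=> NP nb fb; apply: nb => d d0; have cP := nest_subspace NP.
have lb := nest_alg_linear b; have bb := nest_alg_bounded b.
have := fb _ d0; rewrite (orth_proj_orthocomplement hip cP).
have lT : linear (adjoint ip b \o orth_projC ip P).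
  by apply: linear_comp; [exact: adjoint_linear|exact: orth_projC_linear].
have bT : bounded_op (adjoint ip b \o orth_projC ip P).
  by apply: bounded_op_comp; [exact: adjoint_bounded|exact: orth_projC_bounded].
move=> /(adjoint_fin_within hip lT bT (ltW d0)).
rewrite (_ : adjoint _ _ = orth_projC ip P \o b) //.
apply/funext => y; apply: (adjoint_uniq hip lT bT) => x /=.
by rewrite -(orth_projC_adj hip cP) ip_conj -(adjointE hip lb bb) -ip_conj.
Qed.

Lemma not_weakly_compact_min a b (d1 d2 : R) : 0 < d1 -> 0 < d2 ->
  (forall s t : seq H, exists P Q f g, [/\ [/\ N P, N Q &
       forall M, N M -> M `<=` P \/ Q `<=` M],
     [/\ Q f, rn f = 1, forall x, x \in s -> ip f x = 0 & d1 <= rn (a f)] &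
     [/\ orthocomplement ip P g, rn g = 1, forall x, x \in t -> ip g x = 0 &
         d2 <= rn (adjoint ip b g)]]) ->
  ~ weakly_compact_op (mul_op a b).
Proof.
move=> d10 d20 ex; apply: (not_weakly_compact hip (d := Num.min d1 d2)).
  by rewrite lt_min d10.
move=> s t; have [P [Q [f [g [[NP NQ PQ] [Qf f1 fs af] [Pg g1 gt bg]]]]]] := ex s t.
exists f, g; split=> //; first exact: (rank_one_nest_alg NP NQ PQ).
by rewrite !ge_min af bg orbT.
Qed.

Let single_chain P : forall Q Q' :
  set H, [set P] Q -> [set P] Q' -> Q `<=` Q' \/ Q' `<=` Q.
Proof. by move=> _ _ -> ->; left. Qed.

(** Applied with [P = Q] or with [Q] the immediate successor of [P]. The [f] are found in [Q] and
    the [g] in the orthocomplement of [P], through chains with one member. *)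
Lemma not_weakly_compact_adjacent a b P Q : N P -> N Q ->
  (forall M, N M -> M `<=` P \/ Q `<=` M) ->
  ~ left_compact a Q -> ~ right_compact b P -> ~ weakly_compact_op (mul_op a b).
Proof.
move=> NP NQ PQ na nb; have cP := nest_subspace NP; have cQ := nest_subspace NQ.
have lb := nest_alg_linear b; have bb := nest_alg_bounded b.
have cPC := orthocomplement_closed_subspace hip cP.
have [|||||d1 d10 large_a] := @large_of_not_fin_within _ _ _ hip a
  (nest_alg_linear a) (nest_alg_bounded a) Q [set Q] cQ.
- by exists Q.
- by move=> _ ->; exact: cQ.2.
- exact: single_chain.
- by rewrite bigcup_set1; exact: subset_closure.
- exact: na.
have [|||||d2 d20 large_b] := @large_of_not_fin_within _ _ _ hip _
  (adjoint_linear hip lb bb) (adjoint_bounded hip lb bb) _ [set orthocomplement ip P] cPC.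
- by exists (orthocomplement ip P).
- by move=> _ ->; exact: cPC.2.
- exact: single_chain.
- by rewrite bigcup_set1; exact: subset_closure.
- exact: adjoint_not_fin_within.
apply: (not_weakly_compact_min d10 d20) => s t.
have [_ [f [-> Qf f1 fs af]]] := large_a s; have [_ [g [-> Pg g1 gt bg]]] := large_b t.
by exists P, Q, f, g.
Qed.

Let nest_split P : N P -> forall M, N M -> M `<=` P \/ P `<=` M.
Proof. by move=> NP M NM; exact: (nest_total NM NP). Qed.

(** Here [S] is the infimum of the members above it, so the orthocomplements of these have dense
    union in that of [S]. First [g] is found in the orthocomplement of some [P] above [S], then
    [large_in_chain] gives [f] inside this same [P]. *)
Lemma not_weakly_compact_above a b S (e : R) (W := [set P | N P /\ S `<` P]) :
  N S -> ~ right_compact b S -> W !=set0 -> \bigcap_(P in W) P `<=` S -> 0 < e ->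
  (forall P, N P -> S `<` P -> e <= opnorm (a \o (orth_proj ip P \- orth_proj ip S))) ->
  ~ weakly_compact_op (mul_op a b).
Proof.
move=> NS nb W0 WS e0 ea; have cS := nest_subspace NS.
have lb := nest_alg_linear b; have bb := nest_alg_bounded b.
have cSC := orthocomplement_closed_subspace hip cS.
have cW P : W P -> closed_subspace P by move=> [/nest_subspace].
have chW P Q : W P -> W Q -> P `<=` Q \/ Q `<=` P.
  by move=> [NP _] [NQ _]; exact: (nest_total NP NQ).
have smallW x (d : R) : (forall z, S z -> ip x z = 0) -> 0 < d ->
    exists2 P, W P & rn (orth_proj ip P x) < d.
  move=> xS d0; apply: (orth_proj_chain_small hip) => // z Wz.
  by apply: xS; apply: WS => P; exact: Wz.
have [|||||d2 d20 large_b] := @large_of_not_fin_within _ _ _ hip _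
  (adjoint_linear hip lb bb) (adjoint_bounded hip lb bb) _ [set orthocomplement ip P | P in W] cSC.
- by case: W0 => P WP; exists (orthocomplement ip P), P.
- by move=> _ [P WP <-]; have [] := orthocomplement_closed_subspace hip (cW _ WP).
- move=> _ _ [P WP <-] [Q WQ <-]; have [PQ|QP] := chW _ _ WP WQ; [right|left].
  + by move=> z Qz y Py; apply: Qz; exact: PQ.
  + by move=> z Pz y Qy; apply: Pz; exact: QP.
- move=> m Sm; apply/closureP => d d0; have [P WP Pm] := smallW _ _ Sm d0.
  exists (orth_projC ip P m); last by rewrite /orth_projC subKr.
  by exists (orthocomplement ip P);
    [exists P|exact: (orthocomplement_proj hip _ (cW _ WP))].
- exact: adjoint_not_fin_within.
have e2 : 0 < e / 2 by rewrite divr_gt0.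
have large_a := @large_in_chain _ _ _ hip a (nest_alg_linear a)
  (nest_alg_bounded a) W S (e / 2) cS e2.
apply: (not_weakly_compact_min (d1 := e / 2 / 2) (d2 :=
  d2)) => // [|s t]; first by rewrite divr_gt0.
have [_ [g [[P WP <-] Pg g1 gt bg]]] := large_b t.
have [||||f [Pf f1 fs af]] := large_a _ _ _ _ P WP s.
- by move=> Q WQ; split; [exact: cW|case: WQ => _ []].
- exact: chW.
- exact: smallW.
- move=> Q [NQ SQ]; apply: contrapT => nox; have :=
  ea Q NQ SQ; apply/negP; rewrite -ltNge.
  apply: (@le_lt_trans _ _ (e / 2)); last by lra.
  apply: opnorm_le => x; rewrite Re_norm_le1 => x1; rewrite leNgt; apply/negP => xe.
  by apply: nox; exists x.
by case: WP => NP _; exists P, P, f, g; split=> //; split=> //; exact: nest_split.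
Qed.

(** Dual to [not_weakly_compact_above]: first [f] is found in some [P] below [S], then [g] in the
    orthocomplement of [P], by [large_in_chain] for the adjoint of [b] and the chain of
    orthocomplements. *)
Lemma not_weakly_compact_below a b S (e : R) (W := [set P | N P /\ P `<` S]) :
  N S -> ~ left_compact a S -> W !=set0 -> S `<=` closure (\bigcup_(P in W) P) -> 0 < e ->
  (forall P, N P -> P `<` S -> e <= opnorm ((orth_proj ip S \- orth_proj ip P) \o b)) ->
  ~ weakly_compact_op (mul_op a b).
Proof.
move=> NS na W0 WS e0 eb; have cS := nest_subspace NS.
have lb := nest_alg_linear b; have bb := nest_alg_bounded b.
have cSC := orthocomplement_closed_subspace hip cS.
have cW P : W P -> closed_subspace P by move=> [/nest_subspace].
have chW P Q : W P -> W Q -> P `<=` Q \/ Q `<=` P.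
  by move=> [NP _] [NQ _]; exact: (nest_total NP NQ).
have [|||||d1 d10 large_a] := @large_of_not_fin_within _ _ _ hip a
  (nest_alg_linear a) (nest_alg_bounded a) S W cS.
- exact: W0.
- by move=> P /cW[].
- exact: chW.
- exact: WS.
- exact: na.
have e2 : 0 < e / 2 by rewrite divr_gt0.
have large_b := @large_in_chain _ _ _ hip _ (adjoint_linear hip lb bb)
  (adjoint_bounded hip lb bb) [set orthocomplement ip P | P in W] _ (e / 2) cSC e2.
apply: (not_weakly_compact_min (d1 := d1) (d2 :=
  e / 2 / 2)) => // [|s t]; first by rewrite divr_gt0.
have [P [f [WP Pf f1 fs af]]] := large_a s.
have [|||||g [Pg g1 gt bg]] := large_b _ _ _ _ (orthocomplement ip P) _ t.
- move=> _ [Q WQ <-]; split; first exact: (orthocomplement_closed_subspace hip (cW _ WQ)).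
  by move=> z Sz y Qy; apply: Sz; case: WQ => _ [QS _]; exact: QS.
- move=> _ _ [P' WP' <-] [Q WQ <-]; have [PQ|QP] := chW _ _ WP' WQ; [right|left].
  + by move=> z Qz y Py; apply: Qz; exact: PQ.
  + by move=> z Pz y Qy; apply: Pz; exact: QP.
- move=> x d xS d0; have /WS/closureP/(_ _ d0)[y [Q WQ Qy] xy] :
  S x by exact: (orthocomplementK hip cS).
  exists (orthocomplement ip Q); first by exists Q.
  rewrite (orth_proj_orthocomplement hip (cW _ WQ)) -[x](subrK y).
  rewrite (linear_D (orth_projC_linear hip (cW _ WQ))) (orth_projC_id hip (cW _
    WQ) Qy) addr0.
  exact: le_lt_trans (orth_projC_le hip (cW _ WQ) _) xy.
- move=> _ [Q WQ <-]; have [NQ QS] := WQ; have cQ := cW _ WQ.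
  apply: contrapT => nox; have := eb Q NQ QS; apply/negP; rewrite -ltNge.
  apply: (@le_lt_trans _ _ (e / 2)); last by lra.
  apply: opnorm_le => x; rewrite Re_norm_le1 =>
    x1; apply: (rn_le_ip hip); first exact: ltW.
  move=> y y1; have : rn (adjoint ip b (orth_proj ip S y - orth_proj ip Q y)) <= e / 2.
    rewrite leNgt; apply/negP => ye; apply: nox; exists y => //.
    rewrite !orth_proj_orthocomplement // /orth_projC.
    by rewrite opprB addrC addrA subrK.
  move=> /(ler_pM (Re_norm_ge0 _) (Re_norm_ge0 x))/(_ x1); rewrite mulr1.
  apply: le_trans; rewrite [leRHS]mulrC.
  rewrite (_ : ip _ y = ip x (adjoint ip b (orth_proj ip S y - orth_proj ip Q y))).
    exact: ip_CauchySchwarz.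
  by rewrite -(adjointE hip lb bb) linearBr linearBl /= !(orth_proj_adj hip).
- by exists P.
by case: WP => NP _; exists P, P, f, g; split=> //; split=> //; exact: nest_split.
Qed.

End NestCompressions.

(** * The extremal subspaces *)

Section Extremal.
Context {R : realType} {H : completeNormedModType R[i]}.
Variables (ip : {dot H for Num.conj}) (hip : inner_product_norm ip).
Variable N : nest H.
Implicit Types (a b : nest_alg N) (P Q S : set H).

Lemma sub_closed_span (A : set H) : A `<=` closed_span A.
Proof. by move=> x Ax; apply: subset_closure => B [_ AB]; exact: AB. Qed.

(** The union of a nonempty chain of subspaces is already a subspace. *)
Lemma closed_span_chain (W : set (set H)) : W !=set0 ->
  (forall P, W P -> N P) ->
  closed_span (\bigcup_(P in W) P) = closure (\bigcup_(P in W) P).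
Proof.
move=> W0 WN; apply/seteqP; split; last first.
  by apply: closureS => x Wx B [_ AB]; exact: AB.
apply: closureS => x; apply; split=> //.
apply: bigcup_chain_subspace => // [P /WN NP|P Q /WN NP /WN NQ].
  exact: (nest_subspace NP).2.
exact: (nest_total NP NQ).
Qed.

Lemma nest_upper_space a : N (upper_space ip a).
Proof. by apply: nest_span => P []. Qed.

Lemma nest_lower_space b : N (lower_space ip b).
Proof. by apply: nest_bigcap => P []. Qed.

Lemma sub_upper_space a P : N P -> left_compact ip a P -> P `<=` upper_space ip a.
Proof.
move=> NP aP x Px; apply: sub_closed_span; exists P => //.
by split=> //; exact/(left_compactP hip).
Qed.

Lemma lower_space_sub b P : N P -> right_compact ip b P -> lower_space ip b `<=` P.
Proof. by move=> NP bP x; apply; split=> //; exact/(right_compactP hip). Qed.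

(** If [a P] is not compact, every member [Q] with [a Q] compact lies in [P], and so does their
    closed span. *)
Lemma left_compact_below a P : N P -> ~ upper_space ip a `<=` P -> left_compact ip a P.
Proof.
move=> NP UP; apply: contrapT => naP; apply: UP.
have cP := nest_subspace NP.
have AP : \bigcup_(Q in [set Q | N Q /\ compact_op (orth_proj ip Q \o a \o
  orth_proj ip Q)]) Q `<=` P.
  move=> x [Q [NQ /(left_compactP hip a NQ) aQ] Qx].
  have [PQ|QP] := nest_total NP NQ; last exact: QP.
  by exfalso; apply: naP; exact: (left_compact_sub hip NP NQ PQ).
rewrite [X in _ `<=` X](closure_id P).1; last exact: cP.1.
by apply: closureS => x; apply; split=> //; exact: cP.2.
Qed.

Lemma right_compact_above b P : N P -> ~ P `<=` lower_space ip b -> right_compact ip b P.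
Proof.
move=> NP PL; apply: contrapT => nbP; apply: PL =>
  x Px Q [NQ /(right_compactP hip b NQ) bQ].
have [PQ|QP] := nest_total NP NQ; first exact: PQ.
by exfalso; apply: nbP; exact: (right_compact_sub hip NQ NP QP).
Qed.

(** In [a P = a S + a (P - S)] the first term is compact and the second is small, while [P~ b] is
    compact. *)
Lemma weakly_compact_right_gap a b S : N S -> left_compact ip a S ->
  (forall P, N P -> S `<` P -> right_compact ip b P) ->
  (forall e : R, 0 < e -> exists P, [/\ N P, S `<` P &
     opnorm (a \o (orth_proj ip P \- orth_proj ip S)) < e]) ->
  weakly_compact_op (mul_op a b).
Proof.
move=> NS aS bP gap; apply: (mul_op_weakly_compact hip) => d d0.
have cS := nest_subspace NS; have la := nest_alg_linear a.
have d2 : 0 < d / 2 by rewrite divr_gt0.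
have [P [NP SP Pd]] := gap _ d2; have cP := nest_subspace NP.
exists P; split=> //; last exact: bP.
have -> : a \o orth_proj ip P = (fun x => (a \o orth_proj ip S) x +
    (a \o (orth_proj ip P \- orth_proj ip S)) x).
  by apply/funext => x /=; rewrite -(linear_D la) addrC subrK.
rewrite [d]splitr; apply: fin_within_add => //; first exact: aS.
move=> x x1; apply: le_trans (ltW Pd); apply: opnorm_ub; last by rewrite Re_norm_le1.
apply: bounded_op_comp; first exact: nest_alg_bounded.
exists (1 + 1) => y; rewrite mulrDl mul1r (le_trans (Re_normB _ _)) //.
by rewrite lerD // orth_proj_le.
Qed.

Lemma weakly_compact_left_gap a b S : N S -> right_compact ip b S ->
  (forall P, N P -> P `<` S -> left_compact ip a P) ->
  (forall e : R, 0 < e -> exists P, [/\ N P, P `<` S &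
     opnorm ((orth_proj ip S \- orth_proj ip P) \o b) < e]) ->
  weakly_compact_op (mul_op a b).
Proof.
move=> NS bS aP gap; apply: (mul_op_weakly_compact hip) => d d0.
have cS := nest_subspace NS.
have d2 : 0 < d / 2 by rewrite divr_gt0.
have [P [NP SP Pd]] := gap _ d2; have cP := nest_subspace NP.
exists P; split=> //; first exact: aP.
have -> : orth_projC ip P \o b = (fun x => (orth_projC ip S \o b) x +
    ((orth_proj ip S \- orth_proj ip P) \o b) x).
  by apply/funext => x /=; rewrite /orth_projC addrA subrK.
rewrite [d]splitr; apply: fin_within_add => //; first exact: bS.
move=> x x1; apply: le_trans (ltW Pd); apply: opnorm_ub; last by rewrite Re_norm_le1.
apply: bounded_op_comp; last exact: nest_alg_bounded.
exists (1 + 1) => y; rewrite mulrDl mul1r (le_trans (Re_normB _ _)) //.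
by rewrite lerD // orth_proj_le.
Qed.

Lemma left_compact_zero a : left_compact ip a [set 0].
Proof.
move=> d d0; exists [::]; split=> // x _; rewrite /fproj big_nil subr0.
have /= -> : orth_proj ip [set 0] x =
  0 by exact: (orth_proj_in hip (nest_subspace (nest_zero N))).
by rewrite (linear_0 (nest_alg_linear a)) Re_norm0 ltW.
Qed.

Lemma right_compact_full b : right_compact ip b setT.
Proof.
move=> d d0; exists [::]; split=> // x _; rewrite /fproj big_nil subr0 /=.
by rewrite (orth_projC_id hip (nest_subspace (nest_full N))) // Re_norm0 ltW.
Qed.

(** If [U] is strictly below [L], either some member [P] lies strictly between, where both
    compressions are non-compact, or [L] is the immediate successor of [U]. Both cases fall under
    [not_weakly_compact_adjacent]. *)
Lemma lower_sub_upper a b : weakly_compact_op (mul_op a b) ->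
  lower_space ip b `<=` upper_space ip a.
Proof.
move=> wc; apply: contrapT => LU; move: wc.
set U := upper_space ip a in LU *; set L := lower_space ip b in LU *.
have NU : N U := nest_upper_space a; have NL : N L := nest_lower_space b.
have UL : U `<=` L by have [//|/LU] := nest_total NU NL.
have [[P [NP UP PL]]|noP] := pselect (exists P, [/\ N P, U `<` P & P `<` L]).
  apply: (not_weakly_compact_adjacent hip NP NP).
  - by move=> M NM; exact: (nest_total NM NP).
  - by move=> /(sub_upper_space NP) /UP.2.
  - by move=> /(lower_space_sub NP) /PL.2.
apply: (not_weakly_compact_adjacent hip NU NL).
- move=> M NM; apply: contrapT => /not_orP[MU LM]; apply: noP; exists M; split=> //.
  + by split=> //; have [/MU|] := nest_total NM NU.
  + by split=> //; have [|/LM] := nest_total NM NL.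
- by move=> /(sub_upper_space NL) /LU.
- by move=> /(lower_space_sub NU) /LU.
Qed.

(** The intersection of the members above [S] is either [S], and [not_weakly_compact_above] applies,
    or the immediate successor of [S], where [a] is not compact because it exceeds [U]. *)
Lemma gap_above_of_weakly_compact a b S : upper_space ip a = S ->
  ~ right_compact ip b S -> weakly_compact_op (mul_op a b) ->
  forall e : R, 0 < e -> exists P, [/\ N P, S `<` P &
    opnorm (a \o (orth_proj ip P \- orth_proj ip S)) < e].
Proof.
move=> US nb wc e e0; apply: contrapT => nogap.
have NS : N S by rewrite -US; exact: nest_upper_space.
pose W := [set P | N P /\ S `<` P].
(* The whole space is strictly above [S], as [S = setT] would make [P~ b] vanish for [P = S]. *)
have W0 : W !=set0.
  exists setT; split; first exact: nest_full.
  by split=> // TS; apply: nb; rewrite (_ :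
    S = setT); [exact: right_compact_full|by apply/seteqP; split].
have NW : N (\bigcap_(P in W) P) by apply: nest_bigcap => P [].
have [WS|WS] := pselect (\bigcap_(P in W) P `<=` S); move: wc.
  apply: (not_weakly_compact_above hip NS nb W0 WS e0) => P NP SP.
  by rewrite leNgt; apply/negP => Pe; apply: nogap; exists P.
apply: (not_weakly_compact_adjacent hip NS NW) => // [M NM|/(sub_upper_space NW)].
  have [|SM] := pselect (M `<=` S); [by left|right=> x; apply; split=> //].
  by split=> //; have [/SM|] := nest_total NM NS.
by rewrite US => /WS.
Qed.

(** Dually, the closed span of the members below [S] is either [S] or its immediate predecessor,
    where [b] is not compact because it is strictly below [L]. *)
Lemma gap_below_of_weakly_compact a b S : lower_space ip b = S ->
  ~ left_compact ip a S -> weakly_compact_op (mul_op a b) ->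
  forall e : R, 0 < e -> exists P, [/\ N P, P `<` S &
    opnorm ((orth_proj ip S \- orth_proj ip P) \o b) < e].
Proof.
move=> LS na wc e e0; apply: contrapT => nogap.
have NS : N S by rewrite -LS; exact: nest_lower_space.
have cS := nest_subspace NS.
pose W := [set P | N P /\ P `<` S].
have W0 : W !=set0.
  exists [set 0]; split; first exact: nest_zero.
  split=> [_ ->|S0]; first exact: cS.2.1.
  apply: na; rewrite (_ : S = [set 0]); first exact: left_compact_zero.
  by apply/seteqP; split=> // _ ->; exact: cS.2.1.
have NW : N (closed_span (\bigcup_(P in W) P)) by apply: nest_span => P [].
have [SW|SW] := pselect (S `<=` closed_span (\bigcup_(P in W) P)); move: wc.
  apply: (not_weakly_compact_below hip NS na W0 _ e0).
    by rewrite -closed_span_chain // => P [].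
  move=> P NP PS; rewrite leNgt; apply/negP => Pe; apply: nogap; by exists P.
apply: (not_weakly_compact_adjacent hip NW NS) => // [M NM|/(lower_space_sub NW)].
  have [|SM] := pselect (S `<=` M); [by right|left=> x Mx;
    apply: sub_closed_span; exists M => //].
  by split=> //; split=> //; have [|/SM] := nest_total NM NS.
by rewrite LS => /SW.
Qed.

End Extremal.

(** * The characterization of weakly compact multiplications *)

Theorem theorem4p6 (R : realType) (H : completeNormedModType R[i])
    (ip : {dot H for Num.conj}) (hip : inner_product_norm ip)
    (N : nest H) (a b : nest_alg N) :
  weakly_compact_op (mul_op a b) <->
  [\/ lower_space ip b `<` upper_space ip a,
      exists S : set H,
        [/\ upper_space ip a = S, lower_space ip b = S,
            compact_op (orth_proj ip S \o a \o orth_proj ip S) &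
            compact_op (orth_projC ip S \o b \o orth_projC ip S)],
      exists S : set H,
        [/\ upper_space ip a = S, lower_space ip b = S,
            compact_op (orth_proj ip S \o a \o orth_proj ip S),
            ~ compact_op (orth_projC ip S \o b \o orth_projC ip S) &
            forall e : R, 0 < e -> exists P : set H,
              [/\ N P, S `<` P &
                  opnorm (a \o (orth_proj ip P \- orth_proj ip S)) < e]] |
      exists S : set H,
        [/\ upper_space ip a = S, lower_space ip b = S,
            compact_op (orth_projC ip S \o b \o orth_projC ip S),
            ~ compact_op (orth_proj ip S \o a \o orth_proj ip S) &
            forall e : R, 0 < e -> exists P : set H,
              [/\ N P, P `<` S &
                  opnorm ((orth_proj ip S \- orth_proj ip P) \o b) < e]]].
Proof.
have NU := nest_upper_space ip a; have NL := nest_lower_space ip b.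
split=> [wc|].
  have LU := lower_sub_upper hip wc.
  have [UL|UL] := pselect (upper_space ip a `<=` lower_space ip b); last exact: Or41.
  have [S US] : exists S, upper_space ip a = S by exists (upper_space ip a).
  have LS : lower_space ip b = S by rewrite -US; apply/seteqP; split.
  have NS : N S by rewrite -US.
  have [aS|aS] := pselect (compact_op (orth_proj ip S \o a \o orth_proj ip S));
  have [bS|bS] := pselect (compact_op (orth_projC ip S \o b \o orth_projC ip S)).
  - by apply: Or42; exists S.
  - apply: Or43; exists S; split=> //.
    by apply: (gap_above_of_weakly_compact hip US _ wc) => /(right_compactP hip b NS).
  - apply: Or44; exists S; split=> //.
    by apply: (gap_below_of_weakly_compact hip LS _ wc) => /(left_compactP hip a NS).
  - exfalso; move: wc; apply: (not_weakly_compact_adjacent hip NS NS).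
    + by move=> M NM; exact: (nest_total NM NS).
    + by move=> /(left_compactP hip a NS).
    + by move=> /(right_compactP hip b NS).
case=> [[LU UL]|[S [US LS aS bS]]|[S [US LS aS bS gap]]|[S [US LS bS aS gap]]].
(* A member with [a P] compact that is not inside [L] has [P~ b] compact. If no member had both
   properties, all those spanning [U] would lie in [L], against [L < U]. *)
- have [P [NP aP bP]] : exists P, [/\ N P, left_compact ip a P & right_compact ip b P].
    apply: contrapT => noP; apply: UL.
    rewrite [X in _ `<=` X](closure_id _).1; last exact: (nest_subspace NL).1.
    apply: closureS => x; apply; split; first exact: (nest_subspace NL).2.
    move=> y [P [NP /(left_compactP hip a NP) aP] Py]; apply: contrapT => Ly.
    apply: noP; exists P; split=> //; apply: (right_compact_above hip) => // PL.
    by apply: Ly; exact: PL.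
  by apply: (mul_op_weakly_compact hip) => d d0; exists P; split; [|exact: aP|exact: bP].
- have NS : N S by rewrite -US.
  apply: (mul_op_weakly_compact hip) => d d0; exists S; split=> //.
  + exact: (left_compactP hip a NS).1.
  + exact: (right_compactP hip b NS).1.
- have NS : N S by rewrite -US.
  apply: (weakly_compact_right_gap hip NS _ _ gap); first exact/(left_compactP hip).
  by move=> P NP [_ PS]; apply: (right_compact_above hip) => //; rewrite LS.
- have NS : N S by rewrite -US.
  apply: (weakly_compact_left_gap hip NS _ _ gap); first exact/(right_compactP hip).
  by move=> P NP [_ SP]; apply: (left_compact_below hip) => //; rewrite US.
Qed.
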